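(* For all integers $k\ge 1$ and all $n>1$, the generating function of the Betti numbers of the cut ideal $J_{k,n}$ satisfies $$\tilde G_{k,n}(x,t)=x^{-(k-1)}\Bigl((1+tx)\bigl(1+\tilde G_{k,n-1}(x,t)\bigr)-1\Bigr)^k .$$
   Context: $T_{k,n}$ is the complete $k$-ary rooted tree of depth $n$: every non-leaf node has exactly $k$ children and all leaves are at distance $n$ from the root. Let $K$ be a field and let $S_{k,n}=K[x_e: e\in E(T_{k,n})]$ be the standard graded polynomial ring with one variable per edge. The path ideal $I_{k,n}\subset S_{k,n}$ is generated by the monomials $\prod_{e\in P}x_e$, where $P$ runs over the edge sets of the paths from the root to each leaf. The cut ideal $J_{k,n}$ is the squarefree Alexander dual of $I_{k,n}$, i.e. $J_{k,n}=\bigcap_{P}\langle x_e: e\in P\rangle$ over all root-to-leaf paths $P$; equivalently, it is generated by the monomials $\prod_{e\in C}x_e$ over the sets $C$ of edges whose removal disconnects the root from all leaves. With graded Betti numbers $\beta_{i,j}(M)=\dim_K\mathrm{Tor}_i^{S_{k,n}}(M,K)_j$, set $$\tilde G_{k,n}(x,t)=\sum_{i,j>0}\beta_{i,j}(S_{k,n}/J_{k,n})\,x^i t^j .$$ (In particular $\tilde G_{k,1}(x,t)=t^k x$.) *)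

(* Defs.v *)
From Stdlib Require Import ClassicalEpsilon.
From HB Require Import structures.
From mathcomp Require Import all_boot all_order all_algebra.
From mathcomp.multinomials Require Import mpoly.

Set Implicit Arguments.
Unset Strict Implicit.
Unset Printing Implicit Defensive.

Import GRing.Theory.
Local Open Scope ring_scope.

(* The vertices of T_{k,n} are the words of length at most n over {0..k-1}:
   the empty word is the root and the children of v are the words rcons v i. *)
Section Tree.
Variables k n : nat.

Definition vertex : finType := n.-bseq 'I_k.

Definition tree_root : vertex := [bseq].

Definition child : rel vertex :=
  fun v w => [exists i : 'I_k, (w : seq 'I_k) == rcons v i].

Definition leaf (v : vertex) : bool := [forall w, ~~ child v w].

Definition edge : finType := {p : vertex * vertex | child p.1 p.2}.

(* p lists the vertices after the root. *)
Definition root_leaf_path (p : seq vertex) : bool :=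
  path child tree_root p && leaf (last tree_root p).

Definition path_edges (p : seq vertex) : {set edge} :=
  [set e : edge | val e \in zip (tree_root :: p) p].

End Tree.

Section CutIdeal.
Variables (K : fieldType) (k n : nat).

Definition edge_ring := {mpoly K[#|{: edge k n}|]}.

Definition edge_var (e : edge k n) : edge_ring := 'X_(enum_rank e).

Definition var_ideal (A : {set edge k n}) (f : edge_ring) : Prop :=
  exists c : edge k n -> edge_ring, f = \sum_(e in A) c e * edge_var e.

Definition cut_ideal (f : edge_ring) : Prop :=
  forall p, root_leaf_path p -> var_ideal (path_edges p) f.

End CutIdeal.

(* Graded resolutions of S/J by graded free modules of finite rank
     F_i = \bigoplus_b S(- gdeg b),   b : 'I_(rk i).
   Elements of F_i are row vectors, and the matrices act on the right:
   diff i : F_{i+1} -> F_i, while aug lifts the augmentation F_0 -> S/J to S.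
   The two homogeneity axioms say that these maps have degree 0. *)
Record graded_resolution (K : fieldType) (m : nat)
    (J : {mpoly K[m]} -> Prop) := GradedResolution {
  rk : nat -> nat;
  gdeg : forall i, 'I_(rk i) -> nat;
  diff : forall i, 'M[{mpoly K[m]}]_(rk i.+1, rk i);
  aug : 'cV[{mpoly K[m]}]_(rk 0);
  diff_homog : forall i b a (u : 'X_{1..m}),
    u \in msupp (diff i b a) -> (mdeg u + gdeg a)%N = gdeg b;
  aug_homog : forall a (u : 'X_{1..m}),
    u \in msupp (aug a ord0) -> mdeg u = gdeg a;
  aug_onto : forall f : {mpoly K[m]},
    exists v : 'rV_(rk 0), J (f - (v *m aug) ord0 ord0);
  exact_0 : forall v : 'rV_(rk 0),
    J ((v *m aug) ord0 ord0) <-> exists w, v = w *m diff 0;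
  exact_S : forall i (v : 'rV_(rk i.+1)),
    v *m diff i = 0 <-> exists w, v = w *m diff i.+1
}.

Section Betti.
Variables (K : fieldType) (m : nat) (J : {mpoly K[m]} -> Prop).

Section Tor.
Variable F : graded_resolution J.

(* F_i (x)_S K is K^(rk i), and its differential is diff i with every entry
   reduced modulo the ideal of the variables. *)
Definition diffK (i : nat) : 'M[K]_(rk F i.+1, rk F i) :=
  map_mx (mcoeff 0%MM) (diff F i).

(* Row space: the degree j component of F_i (x)_S K. *)
Definition degree_part (i j : nat) : 'M[K]_(rk F i) :=
  diag_mx (\row_b (gdeg b == j)%:R).

Definition cycles (i j : nat) : 'M[K]_(rk F i) :=
  match i return 'M[K]_(rk F i) with
  | 0 => degree_part 0 j
  | i'.+1 => (degree_part i'.+1 j :&: kermx (diffK i'))%MS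
  end.

Definition boundaries (i j : nat) : 'M[K]_(rk F i.+1, rk F i) :=
  degree_part i.+1 j *m diffK i.

(* The row space of boundaries is contained in that of cycles, so that the
   truncated subtraction is exact. *)
Definition tor_dim (i j : nat) : nat :=
  (\rank (cycles i j) - \rank (boundaries i j))%N.

End Tor.

(* dim_K Tor_i(S/J, K)_j, for J a homogeneous ideal of S: a resolution then
   exists, and the value does not depend on which one is chosen. *)
Definition betti (i j : nat) : nat :=
  epsilon (inhabits 0%N) (fun b => exists F : graded_resolution J, b = tor_dim F i j).

(* G is the generating function sum_{i,j>0} betti i j x^i t^j, as an element
   of Z[t][x]. *)
Definition betti_genfun (G : {poly {poly int}}) : Prop :=
  forall i j : nat,
    G`_i`_j = (if (0 < i)%N && (0 < j)%N then betti i j else 0%N)%:Z.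

End Betti.

(* Main.v *)
From Stdlib Require Import ClassicalEpsilon.
Require Import Defs.
From HB Require Import structures.
From mathcomp Require Import all_boot all_order all_algebra ring.
From mathcomp.multinomials Require Import mpoly.
From mathcomp.real_closed Require Import mxtens.

Set Implicit Arguments.
Unset Strict Implicit.
Unset Printing Implicit Defensive.

Import GRing.Theory.
Local Open Scope ring_scope.

(** Every root-to-leaf path of the tree of depth n+1 starts with one of the k
edges y_i at the root and goes on in the i-th subtree, so the cut ideal is the
intersection over i of the ideals J_i + (y_i), where J_i is the cut ideal of
the i-th subtree.  The k ideals involve disjoint sets of variables.  Let P be
the generating function of the Betti numbers of an ideal of this kind, as a
module, so that those of its quotient ring give 1 + x P.
- Adding a new variable y turns 1 + x P into (1 + t x)(1 + x P), that is, P
  into P + t + t x P: the new resolution is the mapping cone of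
  multiplication by y.
- Intersecting two ideals in disjoint variables multiplies their functions P:
  the intersection is the product, and its resolution is the tensor product
  over K of the two resolutions.
Hence P_(n+1) = (P_n + t + t x P_n)^k, which is the assertion after the
substitution G = x P.  The recursion starts at depth 0, where J = 0 and P = 0.

All these ideals are generated by squarefree monomials, and all the resolutions
are multigraded with squarefree shifts.  So the constructions are made over
the field K: a labelled complex is a finite complex of based K-vector spaces
whose basis elements (cells) are labelled by sets of variables.  It yields a
resolution of J as soon as, for every set U of variables, the cells with label
inside U form a complex augmented to K that is contractible if the squarefree
monomial of U is in J, and there are no such cells otherwise.  Contractions are
given by explicit homotopies, for which the cone and the tensor product reduce
to matrix identities ([resolves_cone], [resolves_tensor]).  Multiplying each
entry of the differential by the quotient of the monomials of its two labels
gives a resolution over the polynomial ring, because exactness can be tested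
one multidegree at a time ([monbd_exact]).  It is minimal, because the labels
strictly increase along the differential ([cell_resolution_minimal]), so its
Betti numbers count its cells ([tor_dim_cell_resolution]).

That any resolution computes the same numbers is the comparison theorem: two
resolutions of the same homogeneous ideal are related by graded chain maps
which are inverse to each other up to homotopy ([chain_map], [null_homotopy],
[betti_tor_dim]). *)

(** * Labelled complexes over a field *)

Section LabelledComplexes.
Variables (K : fieldType) (m : nat).

(** Row b of [bd] is the boundary of the cell b, and [eps] is the augmentation
to K.  Degrees and labels are row vectors so that block constructions on
complexes act on them through [row_mx]. *)
Record labelled_complex := LabelledComplex {
  lsize : nat;
  hdeg : 'rV[nat]_lsize;
  lab : 'rV[{set 'I_m}]_lsize;
  bd : 'M[K]_lsize;
  eps : 'cV[K]_lsize
}.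

Implicit Types (L : labelled_complex) (A U : {set 'I_m}) (Q : {set 'I_m} -> bool).

Definition sgn L : 'M[K]_(lsize L) :=
  diag_mx (map_mx (fun h => (-1) ^+ h) (hdeg L)).

Definition restr L U : 'M[K]_(lsize L) :=
  diag_mx (map_mx (fun B : {set 'I_m} => (B \subset U)%:R) (lab L)).

(** [eta] is a base point and [H] contracts onto it the subcomplex of the cells
with label inside U.  The commutation rules with signs and augmentations are
those that make contractions stable under tensor product; that H raises degrees
by one is recorded only through them. *)
Record contraction L U (H : 'M[K]_(lsize L)) (eta : 'rV[K]_(lsize L)) : Prop :=
  Contraction {
    contr_restrl : restr L U *m H = H;
    contr_restrr : H *m restr L U = H;
    contr_sgn : H *m sgn L = - (sgn L *m H);
    contr_eps : H *m eps L = 0;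
    base_restr : eta *m restr L U = eta;
    base_sgn : eta *m sgn L = eta;
    base_bd : eta *m bd L = 0;
    base_eps : eta *m eps L = 1;
    contr_homotopy : restr L U *m bd L *m H + H *m bd L
                     = restr L U - restr L U *m eps L *m eta
  }.

(** The labels use the variables of A, and Q tells which sets U of variables
have their monomial in the ideal that is resolved.  By [lab_up] no cell lies in
U unless Q U holds, and by [contractible] those cells have the homology of a
point when it does. *)
Record resolves L A Q : Prop := Resolves {
  bd_supp : forall b a, bd L b a != 0 ->
    hdeg L 0 b = (hdeg L 0 a).+1 /\ lab L 0 a \proper lab L 0 b;
  eps_supp : forall b, eps L b 0 != 0 -> hdeg L 0 b = 0%N;
  bd_bd : bd L *m bd L = 0;
  bd_eps : bd L *m eps L = 0;
  lab_sub : forall b, lab L 0 b \subset A;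
  lab_up : forall b U, lab L 0 b \subset U -> Q U;
  contractible : forall U, Q U -> exists H eta, @contraction L U H eta
}.

Lemma sgn_bd L A Q : resolves L A Q -> sgn L *m bd L = - (bd L *m sgn L).
Proof.
move=> rL; apply/matrixP=> b a.
rewrite mul_diag_mx mxE [RHS]mxE mul_mx_diag !mxE.
have [->|nz] := eqVneq (bd L b a) 0; first by rewrite mulr0 mul0r oppr0.
by have [-> _] := bd_supp rL nz; rewrite exprS mulN1r mulNr mulrC.
Qed.

Lemma sgn_eps L A Q : resolves L A Q -> sgn L *m eps L = eps L.
Proof.
move=> rL; apply/matrixP=> b a; rewrite ord1 mul_diag_mx !mxE.
have [->|nz] := eqVneq (eps L b 0) 0; first by rewrite mulr0.
by rewrite (eps_supp rL nz) mul1r.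
Qed.

Lemma sgn_sgn L : sgn L *m sgn L = 1%:M.
Proof.
apply/matrixP=> b a; rewrite mul_diag_mx !mxE.
by rewrite mulrnAr -expr2 sqrr_sign.
Qed.

Lemma sgn_restr L U : sgn L *m restr L U = restr L U *m sgn L.
Proof. exact: diag_mxC. Qed.

Lemma restr_restr L U : restr L U *m restr L U = restr L U.
Proof.
apply/matrixP=> b a; rewrite mul_diag_mx !mxE.
by case: (_ \subset _); rewrite ?mul1r ?mul0r ?mul0rn.
Qed.

Lemma restr_bd L A Q U : resolves L A Q ->
  restr L U *m bd L *m restr L U = restr L U *m bd L.
Proof.
move=> rL; apply/matrixP=> b a; rewrite mul_mx_diag mul_diag_mx !mxE.
have [->|nz] := eqVneq (bd L b a) 0; first by rewrite mulr0 mul0r.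
have [_ /proper_sub lt_ab] := bd_supp rL nz.
have [sbU|_] := boolP (lab L 0 b \subset U); last by rewrite !mul0r.
by rewrite (subset_trans lt_ab sbU) mulr1.
Qed.

Definition cells_genfun L : {poly {poly int}} :=
  \sum_b 'X ^+ hdeg L 0 b * ('X ^+ #|lab L 0 b|)%:P.

(** The carrier of the recursion over the tree: it remembers about a resolution
only its number of cells of each degree and label size. *)
Definition resolvable A Q (P : {poly {poly int}}) :=
  exists2 L, resolves L A Q & cells_genfun L = P.

Lemma resolvable_ext A Q Q' P : Q =1 Q' -> resolvable A Q P -> resolvable A Q' P.
Proof.
move=> eQ [L rL <-]; exists L => //; split; try by case: rL.
  by move=> b U /(lab_up rL); rewrite eQ.
by move=> U; rewrite -eQ; apply: (contractible rL).
Qed.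

Lemma resolvable_zero : resolvable set0 (fun=> false) 0.
Proof.
exists (@LabelledComplex 0 0 (const_mx set0) 0 0); last by rewrite /cells_genfun big_ord0.
by split=> //=; rewrite ?mulmx0 //; case.
Qed.

(** The unit ideal, resolved by one cell with empty label; it is the neutral
element of the intersections of ideals below. *)
Lemma resolvable_unit : resolvable set0 (fun=> true) 1.
Proof.
exists (@LabelledComplex 1 0 (const_mx set0) 0 1); last first.
  by rewrite /cells_genfun big_ord1 !mxE cards0 !expr0 mul1r.
split=> //=; rewrite ?mulmx0 ?mul0mx //.
- by move=> b a; rewrite mxE eqxx.
- by move=> b _; rewrite mxE.
- by move=> b; rewrite mxE sub0set.
move=> U _; exists 0, 1.
have restrE : @restr (@LabelledComplex 1 0 (const_mx set0) 0 1) U = 1%:M.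
  by apply/matrixP=> i j; rewrite !mxE sub0set.
have sgnE : @sgn (@LabelledComplex 1 0 (const_mx set0) 0 1) = 1%:M.
  by apply/matrixP=> i j; rewrite !mxE expr0.
split; rewrite /= ?restrE ?sgnE ?(mulmx0, mul0mx, mulmx1, mul1mx) ?oppr0 ?addr0 //.
by rewrite subrr.
Qed.

(** The complex extended by one cell, at index 0, for the polynomial ring in the
resolution of its quotient by the ideal: its boundary is zero, and the
augmentation becomes the boundary of the cells of degree 0. *)
Section Aug.
Variable L : labelled_complex.

Definition aug_hdeg : 'rV[nat]_(1 + lsize L) := row_mx (const_mx 0%N) (map_mx S (hdeg L)).
Definition aug_lab : 'rV[{set 'I_m}]_(1 + lsize L) := row_mx (const_mx set0) (lab L).
Definition aug_bd : 'M[K]_(1 + lsize L) := block_mx 0 0 (eps L) (bd L).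

(** That the ideal is proper makes the label increase also along the
augmentation; this is needed for minimality. *)
Lemma aug_bd_supp A Q : resolves L A Q -> ~~ Q set0 -> forall b a, aug_bd b a != 0 ->
    aug_hdeg 0 b = (aug_hdeg 0 a).+1 /\ aug_lab 0 a \proper aug_lab 0 b.
Proof.
move=> rL Q0 b a.
case: (split_ordP b) => {}b ->; rewrite /aug_bd /aug_hdeg /aug_lab ?block_mxEh.
  by case: (split_ordP a) => {}a ->; rewrite ?row_mxEl ?row_mxEr col_mxEu mxE eqxx.
case: (split_ordP a) => {}a ->; rewrite ?row_mxEl ?row_mxEr col_mxEd !mxE.
  rewrite [a]ord1 => /(eps_supp rL) ->; split => //; rewrite proper0.
  by apply/eqP => lb0; move: Q0; rewrite (lab_up rL (b := b)) // lb0.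
by case/(bd_supp rL) => -> ->.
Qed.

Lemma aug_bd_aug_bd A Q : resolves L A Q -> aug_bd *m aug_bd = 0.
Proof.
move=> rL; rewrite mulmx_block !(mul0mx, mulmx0, add0r, addr0).
by rewrite (bd_eps rL) (bd_bd rL) block_mx0.
Qed.

End Aug.

Section Cone.
Variables (L : labelled_complex) (y : 'I_m).

(** The cells are those of L followed by a copy of the augmented complex of L
with y added to the labels.  The extra cell of that copy becomes the generator y
of the ideal. *)
Definition cone : labelled_complex :=
  @LabelledComplex (lsize L + (1 + lsize L))
    (row_mx (hdeg L) (aug_hdeg L))
    (row_mx (lab L) (map_mx (fun B => y |: B) (aug_lab L)))
    (block_mx (bd L) 0 (col_mx 0 1%:M) (- aug_bd L))
    (col_mx (eps L) (col_mx 1 0)).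

Lemma sgn_cone : sgn cone = block_mx (sgn L) 0 0 (block_mx 1 0 0 (- sgn L)).
Proof.
rewrite /sgn /= map_row_mx diag_mx_row; congr (block_mx _ _ _ _).
rewrite map_row_mx diag_mx_row; congr (block_mx _ _ _ _).
  by apply/matrixP=> i j; rewrite !mxE expr0.
by apply/matrixP=> i j; rewrite !mxE exprS mulN1r mulNrn.
Qed.

Lemma restr_cone U : restr cone U =
  block_mx (restr L U) 0 0 (if y \in U then block_mx 1 0 0 (restr L U) else 0).
Proof.
rewrite /restr /= map_row_mx diag_mx_row; congr (block_mx _ _ _ _).
rewrite !map_row_mx diag_mx_row; case: ifP => yU; last first.
  rewrite -[RHS](block_mx0 _ 1 (lsize L) 1 (lsize L)); congr (block_mx _ _ _ _);
  by apply/matrixP=> i j; rewrite !mxE subUset sub1set yU mul0rn.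
congr (block_mx _ _ _ _); apply/matrixP=> i j.
  by rewrite !mxE setU0 sub1set yU.
by rewrite !mxE subUset sub1set yU.
Qed.

Lemma resolves_cone A Q : resolves L A Q -> ~~ Q set0 -> y \notin A ->
  resolves cone (y |: A) (fun U => (y \in U) || Q U).
Proof.
move=> rL Q0 yA.
have ylab b : y \notin lab L 0 b by apply: contra yA => /(subsetP (lab_sub rL b)).
have y_aug_lab b : y \notin aug_lab L 0 b.
  rewrite /aug_lab; case: (split_ordP b) => {}b ->; rewrite ?row_mxEl ?row_mxEr //.
  by rewrite mxE inE.
split=> /=.
- move=> b a; case: (split_ordP b) => {}b ->; case: (split_ordP a) => {}a ->;
    rewrite ?row_mxEl ?row_mxEr
      ?(block_mxEul, block_mxEur, block_mxEdl, block_mxEdr).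
  + exact: (bd_supp rL).
  + by rewrite mxE eqxx.
  + rewrite /aug_hdeg /aug_lab; case: (split_ordP b) => {}b ->.
      by rewrite col_mxEu mxE eqxx.
    rewrite col_mxEd [1%:M _ _]mxE [map_mx _ (row_mx _ _) _ _]mxE !row_mxEr.
    rewrite [map_mx _ _ _ _]mxE.
    have [->|_] := eqVneq b a; last by rewrite eqxx.
    by move=> _; split => //; rewrite properUr // sub1set.
  rewrite mxE oppr_eq0 => /(aug_bd_supp rL Q0) [-> lt_ab]; split => //.
  rewrite ![map_mx _ _ _ _]mxE properEcard setUS ?(proper_sub lt_ab) //=.
  by rewrite !cardsU1 !y_aug_lab ltn_add2l proper_card.
- move=> b; case: (split_ordP b) => {}b ->; rewrite ?(col_mxEu, col_mxEd, row_mxEl, row_mxEr).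
    exact: (eps_supp rL).
  rewrite /aug_hdeg; case: (split_ordP b) => {}b ->;
    by rewrite ?(col_mxEu, col_mxEd, row_mxEl, row_mxEr) !mxE ?eqxx.
- rewrite mulmx_block (bd_bd rL) !mulmx0 !mul0mx !addr0 ?add0r.
  rewrite !mulNmx mulmxN opprK (aug_bd_aug_bd rL) mul_col_mx mul0mx mul1mx.
  rewrite /aug_bd mul_block_col !mul0mx mulmx1 !mulmx0 !add0r.
  by rewrite subrr block_mx0.
- rewrite mul_block_col (bd_eps rL) !mul0mx addr0 mul_col_mx mul0mx mul1mx.
  rewrite mulNmx /aug_bd mul_block_col !mul0mx !mulmx0 !addr0 mulmx1.
  by rewrite opp_col_mx oppr0 add_col_mx addr0 subrr !col_mx0.
- move=> b; case: (split_ordP b) => {}b ->; rewrite ?(row_mxEl, row_mxEr).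
    exact/(subset_trans (lab_sub rL b))/subsetU1.
  rewrite mxE setUS // /aug_lab; case: (split_ordP b) => {}b ->; rewrite ?(row_mxEl, row_mxEr).
    by rewrite mxE sub0set.
  exact: (lab_sub rL).
- move=> b U; case: (split_ordP b) => {}b ->; rewrite ?(row_mxEl, row_mxEr).
    by move/(lab_up rL) => ->; rewrite orbT.
  by rewrite mxE subUset sub1set => /andP[->].
move=> U; have [yU _|yU /=] := boolP (y \in U).
  (* Once y is available the complex is the cone of an identity: contract each
     cell b through its copy y b, onto the cell y. *)
  exists (block_mx 0 (row_mx 0 (restr L U)) 0 0), (row_mx 0 (row_mx 1 0)).
  split; rewrite ?restr_cone ?sgn_cone ?yU /=;
    rewrite ?mulmx_block ?mul_row_block ?mul_block_col ?mul_row_col;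
    rewrite ?(mulmx0, mul0mx, addr0, add0r, mulmx1).
  + by rewrite mul_mx_row mulmx0 restr_restr.
  + by rewrite restr_restr.
  + by rewrite opp_block_mx !oppr0 mul_mx_row mulmx0 opp_row_mx oppr0 mulmxN sgn_restr.
  + by rewrite col_mx0.
  + by [].
  + by [].
  + rewrite mulmxN mul_row_block ?(mulmx0, mul0mx, addr0, add0r, mulmx1).
    by rewrite row_mx0 oppr0 row_mx0.
  + by [].
  rewrite !mul_col_row !mul_mx_row !mulmx0 mulmxN mul_row_block (restr_bd _ rL).
  rewrite !mul0mx restr_restr !add0r.
  rewrite !mulmx1 !opp_block_mx !add_block_mx !opp_row_mx add_row_mx.
  by rewrite ?(addr0, add0r, oppr0, subrr).
(* Without y, only the cells of L remain. *)
move=> /(contractible rL) [H [eta cH]].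
exists (block_mx H 0 0 0), (row_mx eta 0).
case: cH => c1 c2 c3 c4 c5 c6 c7 c8 c9.
split; rewrite ?restr_cone ?sgn_cone ?(negbTE yU) /=;
    rewrite ?mulmx_block ?mul_row_block ?mul_block_col ?mul_row_col;
    rewrite ?(mulmx0, mul0mx, addr0, add0r, mulmx1) ?c1 ?c2 ?c3 ?c4 ?c5 ?c6 ?c7 ?c8 //.
  + by rewrite opp_block_mx !oppr0.
  + by rewrite col_mx0.
  + by rewrite row_mx0.
rewrite mul_col_row !(mulmx0, mul0mx) opp_block_mx !add_block_mx !oppr0 !addr0.
by rewrite c9.
Qed.

Lemma cells_genfun_cone A Q : resolves L A Q -> y \notin A ->
  cells_genfun cone =
  cells_genfun L + 'X%:P + 'X%:P * 'X * cells_genfun L.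
Proof.
move=> rL yA.
have ylab b : y \notin lab L 0 b by apply: contra yA => /(subsetP (lab_sub rL b)).
rewrite /cells_genfun /= big_split_ord /= -addrA; congr (_ + _).
  by apply: eq_bigr => b _; rewrite !row_mxEl.
rewrite big_split_ord big_ord1; congr (_ + _).
  rewrite !row_mxEr [map_mx _ _ _ _]mxE !row_mxEl !mxE setU0 cards1.
  by rewrite expr0 expr1 mul1r.
rewrite mulr_sumr; apply: eq_bigr => b _.
rewrite !row_mxEr ![map_mx _ _ _ _]mxE !row_mxEr cardsU1 ylab.
by rewrite add1n !exprS polyCM mulrACA ['X * _]mulrC.
Qed.

End Cone.

Lemma resolvable_cone A Q y P : resolvable A Q P -> ~~ Q set0 -> y \notin A ->
  resolvable (y |: A) (fun U => (y \in U) || Q U)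
    (P + 'X%:P + 'X%:P * 'X * P).
Proof.
move=> [L rL <-] Q0 yA; exists (cone L y); first exact: resolves_cone.
exact: cells_genfun_cone rL yA.
Qed.

Section Tensor.
Variables (L1 L2 : labelled_complex).
Notation ix k := (@mxtens_unindex (lsize L1) (lsize L2) k).

(** The sign matrix in the second term of the boundary is the Koszul sign. *)
Definition tensor : labelled_complex :=
  @LabelledComplex (lsize L1 * lsize L2)
    (\row_k addn (hdeg L1 0 (ix k).1) (hdeg L2 0 (ix k).2))
    (\row_k (lab L1 0 (ix k).1 :|: lab L2 0 (ix k).2))
    (bd L1 *t 1%:M + sgn L1 *t bd L2)
    (eps L1 *t eps L2).

Lemma sgn_tensor : sgn tensor = sgn L1 *t sgn L2.
Proof.
apply/matrixP=> i j; rewrite !mxE; case: (mxtens_indexP i) => i1 i2.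
case: (mxtens_indexP j) => j1 j2.
rewrite !mxtens_indexK (can_eq (@mxtens_indexK _ _)) xpair_eqE exprD.
by do 2![case: eqP => _]; rewrite ?(mulr0n, mulr1n, mulr0, mul0r).
Qed.

Lemma restr_tensor U : restr tensor U = restr L1 U *t restr L2 U.
Proof.
apply/matrixP=> i j; rewrite !mxE; case: (mxtens_indexP i) => i1 i2.
case: (mxtens_indexP j) => j1 j2.
rewrite !mxtens_indexK (can_eq (@mxtens_indexK _ _)) xpair_eqE subUset -mulnb natrM.
by do 2![case: eqP => _]; rewrite ?(mulr0n, mulr1n, mulr0, mul0r).
Qed.

End Tensor.
End LabelledComplexes.

(** * Tensor products of labelled complexes *)

Section TensmxLinear.
Variable R : pzRingType.

Lemma tensmxDl m n p q (A B : 'M[R]_(m, n)) (C : 'M[R]_(p, q)) :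
  (A + B) *t C = A *t C + B *t C.
Proof. by apply/matrixP=> i j; rewrite !mxE mulrDl. Qed.

Lemma tensmxDr m n p q (A : 'M[R]_(m, n)) (B C : 'M[R]_(p, q)) :
  A *t (B + C) = A *t B + A *t C.
Proof. by apply/matrixP=> i j; rewrite !mxE mulrDr. Qed.

Lemma tensmxNl m n p q (A : 'M[R]_(m, n)) (C : 'M[R]_(p, q)) :
  (- A) *t C = - (A *t C).
Proof. by apply/matrixP=> i j; rewrite !mxE mulNr. Qed.

Lemma tensmxNr m n p q (A : 'M[R]_(m, n)) (C : 'M[R]_(p, q)) :
  A *t (- C) = - (A *t C).
Proof. by apply/matrixP=> i j; rewrite !mxE mulrN. Qed.

End TensmxLinear.

(** The tensor product of two columns has width 1 * 1, which is only convertible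
to 1; the following instances of [tensmx_mul] fix the dimensions to 1. *)
Section TensmxVectors.
Variables (R : comPzRingType) (m n p q : nat) (A : 'M[R]_(m, n)) (B : 'M[R]_(p, q)).

Lemma tensmx_mulc (u : 'cV[R]_n) (v : 'cV[R]_q) :
  (A *t B) *m (u *t v : 'cV[R]_(n * q)) = ((A *m u) *t (B *m v) : 'cV[R]_(m * p)).
Proof. exact: (@tensmx_mul R m n p q 1 1). Qed.

Lemma tensmx_mulr (u : 'rV[R]_m) (v : 'rV[R]_p) :
  (u *t v : 'rV[R]_(m * p)) *m (A *t B) = ((u *m A) *t (v *m B) : 'rV[R]_(n * q)).
Proof. exact: (@tensmx_mul R 1 m 1 p n q). Qed.

Lemma tensmx_mulrc (u : 'rV[R]_m) (v : 'rV[R]_p) (w : 'cV[R]_m) (z : 'cV[R]_p) :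
  (u *t v : 'rV[R]_(m * p)) *m (w *t z : 'cV[R]_(m * p))
  = ((u *m w) *t (v *m z) : 'M[R]_1).
Proof. exact: (@tensmx_mul R 1 m 1 p 1 1). Qed.

Lemma tensmx_mulcr (u : 'rV[R]_m) (v : 'rV[R]_p) (w : 'cV[R]_m) (z : 'cV[R]_p) :
  (w *t z : 'cV[R]_(m * p)) *m (u *t v : 'rV[R]_(m * p))
  = (w *m u) *t (z *m v).
Proof. exact: (@tensmx_mul R m 1 p 1 m p w z u v). Qed.

End TensmxVectors.

Section Tensor.
Variables (K : fieldType) (m : nat) (L1 L2 : labelled_complex K m).
Variables (A1 A2 : {set 'I_m}) (Q1 Q2 : {set 'I_m} -> bool).
Hypotheses (rL1 : resolves L1 A1 Q1) (rL2 : resolves L2 A2 Q2).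
Hypothesis A12 : [disjoint A1 & A2].

Lemma hdeg_tensor b1 b2 :
  hdeg (tensor L1 L2) 0 (mxtens_index (b1, b2)) = addn (hdeg L1 0 b1) (hdeg L2 0 b2).
Proof. by rewrite mxE mxtens_indexK. Qed.

Lemma lab_tensor b1 b2 :
  lab (tensor L1 L2) 0 (mxtens_index (b1, b2)) = lab L1 0 b1 :|: lab L2 0 b2.
Proof. by rewrite mxE mxtens_indexK. Qed.

(** Disjointness of the variables makes the label sizes additive; this also keeps
the labels strictly increasing along the boundary of the tensor product. *)
Lemma card_labU b1 b2 :
  #|lab L1 0 b1 :|: lab L2 0 b2| = addn #|lab L1 0 b1| #|lab L2 0 b2|.
Proof.
apply/eqP; rewrite (leq_card_setU _ _).2.
exact: disjointWl (lab_sub rL1 b1) (disjointWr (lab_sub rL2 b2) A12).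
Qed.

Lemma bd_tensor_supp b a : bd (tensor L1 L2) b a != 0 ->
    hdeg (tensor L1 L2) 0 b = (hdeg (tensor L1 L2) 0 a).+1 /\
    lab (tensor L1 L2) 0 a \proper lab (tensor L1 L2) 0 b.
Proof.
case: (mxtens_indexP b) => b1 b2; case: (mxtens_indexP a) => a1 a2.
rewrite !hdeg_tensor !lab_tensor mxE !tensmxE !mxE.
have [-> | nz1] := eqVneq (bd L1 b1 a1 * (b2 == a2)%:R) 0.
  rewrite add0r; have [->|_] := eqVneq b1 a1; last by rewrite mulr0n mul0r eqxx.
  have [->|/(bd_supp rL2)[-> lt_ab]] := eqVneq (bd L2 b2 a2) 0; first by rewrite mulr0 eqxx.
  rewrite addnS properEcard !card_labU ltn_add2l proper_card //.
  by rewrite setUS // proper_sub.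
move=> _; move: nz1; have [->|_] := eqVneq b2 a2; last by rewrite mulr0 eqxx.
rewrite mulr1 => /(bd_supp rL1)[-> lt_ab].
rewrite addSn properEcard !card_labU ltn_add2r proper_card //.
by rewrite setSU // proper_sub.
Qed.

(** First contract the left factor; its projection onto the base point, [e]
below, leaves the right factor, which is contracted next. *)
Lemma contraction_tensor U H1 eta1 H2 eta2 :
  @contraction _ _ L1 U H1 eta1 -> @contraction _ _ L2 U H2 eta2 ->
  @contraction _ _ (tensor L1 L2) U
    (H1 *t restr L2 U + (restr L1 U *m eps L1 *m eta1) *t H2) (eta1 *t eta2).
Proof.
move=> [a1 a2 a3 a4 a5 a6 a7 a8 a9] [b1 b2 b3 b4 b5 b6 b7 b8 b9].
set e := restr L1 U *m eps L1 *m eta1.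
have re : restr L1 U *m e = e by rewrite /e !mulmxA restr_restr.
have er : e *m restr L1 U = e by rewrite /e -!mulmxA a5.
have es : e *m sgn L1 = e by rewrite /e -!mulmxA a6.
have se : sgn L1 *m e = e.
  by rewrite /e !mulmxA sgn_restr -(mulmxA (restr _ _)) (sgn_eps rL1).
have re0 : restr L1 U *m bd L1 *m e = 0.
  by rewrite /e !mulmxA (restr_bd _ rL1) -(mulmxA (restr _ _)) (bd_eps rL1) mulmx0 !mul0mx.
have ed : e *m bd L1 = 0 by rewrite /e -mulmxA a7 mulmx0.
split; rewrite ?restr_tensor ?sgn_tensor /=.
- by rewrite mulmxDr !tensmx_mul a1 b1 re restr_restr.
- by rewrite mulmxDl !tensmx_mul a2 b2 er restr_restr.
- rewrite mulmxDl mulmxDr !tensmx_mul a3 b3 es se sgn_restr.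
  by rewrite tensmxNl tensmxNr opprD.
- by rewrite mulmxDl !tensmx_mulc a4 b4 tens0mx tensmx0 addr0.
- by rewrite tensmx_mulr a5 b5.
- by rewrite tensmx_mulr a6 b6.
- by rewrite mulmxDr !tensmx_mulr a7 b7 tens0mx tensmx0 addr0.
- rewrite tensmx_mulrc a8 b8; apply/matrixP=> i j; rewrite !mxE.
  by rewrite !ord1 !eqxx mulr1.
rewrite !(mulmxDl, mulmxDr) !tensmx_mulc !tensmx_mulcr !tensmx_mul.
have rsH : restr L1 U *m sgn L1 *m H1 = sgn L1 *m H1.
  by rewrite -sgn_restr -mulmxA a1.
have rse : restr L1 U *m sgn L1 *m e = e by rewrite -mulmxA se.
rewrite !mulmx1 rsH rse re0 ed es a3 restr_restr (restr_bd _ rL2).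
rewrite !tens0mx ?addr0 ?add0r tensmxNl.
(* The two terms that mix the factors cancel by the sign rule. *)
rewrite addrACA [X in X + _ = _]addrACA subrr addr0 -tensmxDl -tensmxDr a9 b9 -/e.
by rewrite tensmxDl tensmxDr tensmxNl tensmxNr addrA subrK.
Qed.

Lemma resolves_tensor :
  resolves (tensor L1 L2) (A1 :|: A2) (fun U => Q1 U && Q2 U).
Proof.
split.
- exact: bd_tensor_supp.
- move=> b; case: (mxtens_indexP b) => b1 b2.
  rewrite hdeg_tensor mxE !mxtens_indexK !ord1 /= mulf_eq0 => /norP[].
  by move=> /(eps_supp rL1) -> /(eps_supp rL2) ->.
- rewrite /= !(mulmxDl, mulmxDr) !tensmx_mul !mulmx1 !mul1mx.
  rewrite (bd_bd rL1) (bd_bd rL2) sgn_sgn (sgn_bd rL1) tens0mx tensmx0 add0r addr0.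
  by rewrite tensmxNl subrr.
- rewrite /= mulmxDl !tensmx_mulc (bd_eps rL1) (bd_eps rL2).
  by rewrite tens0mx tensmx0 addr0.
- move=> b; case: (mxtens_indexP b) => b1 b2.
  by rewrite lab_tensor setUSS ?(lab_sub rL1) ?(lab_sub rL2).
- move=> b U; case: (mxtens_indexP b) => b1 b2.
  rewrite lab_tensor subUset => /andP[].
  by move=> /(lab_up rL1) -> /(lab_up rL2) ->.
move=> U /andP[/(contractible rL1)[H1 [e1 c1]] /(contractible rL2)[H2 [e2 c2]]].
by do 2!eexists; apply: contraction_tensor c1 c2.
Qed.

Lemma cells_genfun_tensor :
  cells_genfun (tensor L1 L2) = cells_genfun L1 * cells_genfun L2.
Proof.
rewrite /cells_genfun big_distrlr pair_bigA /=.
rewrite (reindex (@mxtens_index _ _)) /=; last first.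
  exists (@mxtens_unindex _ _) => k _; [exact: mxtens_indexK|exact: mxtens_unindexK].
apply: eq_bigr => -[b1 b2] _; rewrite hdeg_tensor lab_tensor card_labU.
by rewrite !exprD polyCM mulrACA.
Qed.

End Tensor.

(** Q1 && Q2 describes the intersection of the two ideals, which is also their
product because the variables are disjoint. *)
Lemma resolvable_tensor (K : fieldType) m (A1 A2 : {set 'I_m}) Q1 Q2 P1 P2 :
  resolvable K A1 Q1 P1 -> resolvable K A2 Q2 P2 -> [disjoint A1 & A2] ->
  resolvable K (A1 :|: A2) (fun U => Q1 U && Q2 U) (P1 * P2).
Proof.
move=> [L1 rL1 <-] [L2 rL2 <-] dA; exists (tensor L1 L2); first exact: resolves_tensor.
exact: cells_genfun_tensor rL1 rL2 dA.
Qed.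

(** * Squarefree monomial ideals and multidegree strands *)

Section Monomials.
Variables (K : fieldType) (m : nat).
Implicit Types (A B : {set 'I_m}) (u M : 'X_{1..m}) (f g : {mpoly K[m]}).

Definition mnm_support u : {set 'I_m} := [set i | u i != 0%N].

Lemma mesym1_le A u : (mesym1 A <= u)%MM = (A \subset mnm_support u).
Proof.
apply/mnm_lepP/subsetP => [le_Au i iA | sAu i].
  by move: (le_Au i); rewrite mnmE iA inE -lt0n.
by rewrite mnmE; case: (boolP (i \in A)) => // /sAu; rewrite inE -lt0n.
Qed.

Lemma mnm_support_mesym1 A : mnm_support (mesym1 A) = A.
Proof. by apply/setP=> i; rewrite inE mnmE; case: (i \in A). Qed.

Lemma mnm_supportS u v : (u <= v)%MM -> mnm_support u \subset mnm_support v.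
Proof.
move=> /mnm_lepP le_uv; apply/subsetP => i; rewrite !inE -!lt0n => ui.
exact: leq_trans ui (le_uv i).
Qed.

Lemma mesym1_leS A B : A \subset B -> (mesym1 A <= mesym1 B)%MM.
Proof. by rewrite mesym1_le mnm_support_mesym1. Qed.

Lemma mcoeffMX_if f u v :
  (f * 'X_[u])@_v = if (u <= v)%MM then f@_(v - u) else 0.
Proof.
case: ifP => [le_uv | nle]; first by rewrite -{1}(submK le_uv) addmC mcoeffMX.
apply/eqP; rewrite mcoeff_eq0 (perm_mem (msuppMX f u)).
apply: contraFN nle => /mapP[w _ ->]; apply/mnm_lepP => i.
by rewrite mnmDE leq_addr.
Qed.

(** For an upward closed Q this is the squarefree monomial ideal generated by
the monomials of the sets that satisfy Q. *)
Definition sqf_ideal (Q : {set 'I_m} -> bool) f : Prop :=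
  forall u, u \in msupp f -> Q (mnm_support u).

Lemma sqf_ideal0 Q : sqf_ideal Q 0.
Proof. by move=> u; rewrite msupp0. Qed.

Lemma sqf_idealP Q f :
  sqf_ideal Q f <-> forall u, ~~ Q (mnm_support u) -> f@_u = 0.
Proof.
split=> [Jf u | f0 u]; last by rewrite mcoeff_msupp; apply: contraNT => /f0 ->.
by move=> nQ; apply/eqP; rewrite mcoeff_eq0; apply: contra nQ => /Jf.
Qed.

End Monomials.

(** A scalar matrix d whose nonzero entries increase the labels l becomes, after
multiplication of each entry by a quotient of monomials, a map between free
modules graded by multidegrees.  The part of multidegree M of a row vector is
the scalar vector [strand M]; on strands the map acts as d. *)
Section Strands.
Variables (K : fieldType) (m n : nat) (l : 'I_n -> {set 'I_m}) (d : 'M[K]_n).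
Hypothesis d_supp : forall b a, d b a != 0 -> l a \subset l b.
Notation S := {mpoly K[m]}.
Notation lam b := (mesym1 (l b)).
Implicit Types (U : {set 'I_m}) (M : 'X_{1..m}).

Lemma mesym1_lab_le b a : d b a != 0 -> (lam a <= lam b)%MM.
Proof. by move=> /d_supp /mesym1_leS. Qed.

Definition monbd : 'M[S]_n := \matrix_(b, a) (d b a *: 'X_[lam b - lam a]).

Definition supported U (z : 'rV[K]_n) := forall b, z 0 b != 0 -> l b \subset U.

Definition strand M (v : 'rV[S]_n) : 'rV[K]_n :=
  \row_b (if (lam b <= M)%MM then (v 0 b)@_(M - lam b) else 0).

Definition assemble M (z : 'rV[K]_n) : 'rV[S]_n :=
  \row_b (z 0 b *: 'X_[M - lam b]).

Lemma submBK u v w : (u <= v)%MM -> (v <= w)%MM -> (w - v + (v - u) = w - u :> 'X_{1..m})%MM.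
Proof.
move=> /mnm_lepP le_uv /mnm_lepP le_vw; apply/mnmP => i.
by rewrite mnmDE !mnmBE addnBA // subnK.
Qed.

Lemma strand_monbd M v : strand M (v *m monbd) = strand M v *m d.
Proof.
apply/rowP=> a; rewrite !mxE.
case: ifP => [le_aM | nle_aM]; last first.
  rewrite big1 // => b _; rewrite mxE.
  have [->|nz] := eqVneq (d b a) 0; first by rewrite mulr0.
  case: ifP => [le_bM|_]; last by rewrite mul0r.
  by rewrite (lepm_trans (mesym1_lab_le nz) le_bM) in nle_aM.
rewrite raddf_sum; apply: eq_bigr => b _; rewrite !mxE /= -scalerAr mcoeffZ mcoeffMX_if.
have [->|nz] := eqVneq (d b a) 0; first by rewrite mul0r mulr0.
have le_ab := mesym1_lab_le nz; rewrite mulrC.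
have -> : (lam b - lam a <= M - lam a)%MM = (lam b <= M)%MM.
  apply/mnm_lepP/mnm_lepP => le i; have := le i;
    move/mnm_lepP: le_aM => /(_ i); move/mnm_lepP: le_ab => /(_ i);
    rewrite !mnmBE => h1 h2 h3; last exact: leq_sub2r.
  by rewrite -(subnK h1) -(subnK h2) leq_add2r.
case: ifP => [le_bM|_]; last by [].
suff -> : (M - lam a - (lam b - lam a) = M - lam b)%MM by [].
apply: (@addIm _ (lam b - lam a)%MM); rewrite submBK // submK //.
apply/mnm_lepP => i; rewrite !mnmBE leq_sub2r //.
by move/mnm_lepP: le_bM.
Qed.

Lemma assemble_mul M z : supported (mnm_support M) z ->
  assemble M (z *m d) = assemble M z *m monbd.
Proof.
move=> zM; apply/rowP=> a; rewrite !mxE scaler_suml.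
apply: eq_bigr => b _; rewrite !mxE.
have [->|nzb] := eqVneq (z 0 b) 0; first by rewrite mul0r !scale0r mul0r.
have [->|nz] := eqVneq (d b a) 0; first by rewrite mulr0 !scale0r mulr0.
rewrite -scalerAl -scalerAr scalerA -mpolyXD submBK ?(mesym1_lab_le nz) //.
by rewrite mesym1_le zM.
Qed.

Lemma strand_decomposition v :
  exists s : seq 'X_{1..m}, v = \sum_(M <- s) assemble M (strand M v).
Proof.
pose s := undup (flatten [seq [seq (u + lam b)%MM | u <- msupp (v 0 b)] | b : 'I_n]).
exists s; apply/rowP=> b; apply/mpolyP=> u.
rewrite summxE raddf_sum /=.
have term M : (assemble M (strand M v) 0 b)@_u =
    if M == (u + lam b)%MM then (v 0 b)@_u else 0.
  rewrite !mxE mcoeffZ mcoeffX.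
  have [->|ne] := eqVneq M (u + lam b)%MM.
    rewrite addmK eqxx mulr1; case: ifP => // /mnm_lepP[] i.
    by rewrite mnmDE leq_addl.
  case: ifP => [le_bM|_]; last by rewrite mul0r.
  case: eqP => [eu|]; last by rewrite mulr0.
  by move: ne; rewrite -eu submK ?eqxx.
rewrite (eq_bigr _ (fun M _ => term M)) /=.
have [uv|nuv] := boolP (u \in msupp (v 0 b)).
  rewrite (bigD1_seq (u + lam b)%MM) ?undup_uniq //=; last first.
    rewrite mem_undup; apply/flattenP.
    exists [seq (u + lam b)%MM | u <- msupp (v 0 b)]; apply/mapP; last by exists u.
    by exists b; rewrite ?mem_enum.
  by rewrite eqxx big1 ?addr0 // => M /negbTE ->.
by rewrite (memN_msupp_eq0 nuv) big1 // => M _; rewrite if_same.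
Qed.

Lemma monbd_monbd : d *m d = 0 -> monbd *m monbd = 0.
Proof.
move=> dd; apply/matrixP=> b c; rewrite !mxE.
transitivity ((d *m d) b c *: 'X_[lam b - lam c] : S).
  rewrite mxE scaler_suml; apply: eq_bigr => a _; rewrite !mxE.
  have [->|nzb] := eqVneq (d b a) 0; first by rewrite mul0r !scale0r mul0r.
  have [->|nz] := eqVneq (d a c) 0; first by rewrite mulr0 !scale0r mulr0.
  rewrite -scalerAl -scalerAr scalerA -mpolyXD.
  by rewrite submBK ?(mesym1_lab_le nz) ?(mesym1_lab_le nzb).
by rewrite dd mxE scale0r.
Qed.

End Strands.

Section AugmentedComplex.
Variables (K : fieldType) (m : nat) (L : labelled_complex K m).
Variables (A : {set 'I_m}) (Q : {set 'I_m} -> bool).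
Hypotheses (rL : resolves L A Q) (Q0 : ~~ Q set0).
Notation S := {mpoly K[m]}.
Notation N := (1 + lsize L)%N.
Notation al := (fun b => aug_lab L 0 b).
Notation lam b := (mesym1 (aug_lab L 0 b)).
Notation aug_monbd := (monbd al (aug_bd L)).
Implicit Types (U : {set 'I_m}) (M : 'X_{1..m}).

Lemma aug_bd_lab b a : aug_bd L b a != 0 -> al a \subset al b.
Proof. by move=> /(aug_bd_supp rL Q0)[_ /proper_sub]. Qed.

(** The homotopy, extended by the base point on the extra cell, contracts the
augmented complex. *)
Lemma aug_bd_exact U (z : 'rV[K]_N) : Q U -> supported al U z -> z *m aug_bd L = 0 ->
  exists2 w, supported al U w & z = w *m aug_bd L.
Proof.
move=> /(contractible rL)[H [eta [c1 c2 c3 c4 c5 c6 c7 c8 c9]]] zU.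
rewrite -[z]hsubmxK; set z0 := lsubmx z; set z1 := rsubmx z.
rewrite /aug_bd mul_row_block !mulmx0 !add0r -row_mx0 => /eq_row_mx[ze zd].
have zr : z1 *m restr L U = z1.
  apply/rowP=> b; rewrite mul_mx_diag !mxE.
  have [->|nz] := eqVneq (z 0 (rshift 1 b)) 0; first by rewrite mul0r.
  by have := zU _ nz; rewrite /aug_lab row_mxEr => ->; rewrite mulr1.
exists (row_mx 0 (z1 *m H + z0 *m eta)).
  move=> b; rewrite /aug_lab; case: (split_ordP b) => {}b ->.
    by rewrite !row_mxEl !mxE eqxx.
  rewrite !row_mxEr; have -> : z1 *m H + z0 *m eta = (z1 *m H + z0 *m eta) *m restr L U.
    by rewrite mulmxDl -!mulmxA c2 c5.
  by rewrite mul_mx_diag !mxE; case: (_ \subset _) => //; rewrite mulr0 eqxx.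
rewrite mul_row_block !mulmx0 !add0r !mulmxDl -!mulmxA c4 c7 c8 mulmx0 mulmx0 mulmx1 add0r addr0.
congr row_mx; rewrite -[in LHS]zr.
have -> : restr L U = restr L U *m bd L *m H + H *m bd L + restr L U *m eps L *m eta.
  by rewrite c9 subrK.
by rewrite !mulmxDr !mulmxA zr zd ze !mul0mx add0r addr0.
Qed.

(** Exactness of the resolution of the quotient by the ideal.  Only the
coordinate 0 can have strands outside the ideal, whence the first hypothesis;
vectors of positive degree satisfy it trivially. *)
Lemma monbd_exact (v : 'rV[S]_N) : sqf_ideal Q (v 0 0) -> v *m aug_monbd = 0 ->
  exists w, v = w *m aug_monbd.
Proof.
move=> Jv vD; have [s ->] := (strand_decomposition al) v.
elim/big_ind: _ => [|_ _ [w1 ->] [w2 ->]|M _].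
- by exists 0; rewrite mul0mx.
- by exists (w1 + w2); rewrite mulmxDl.
have sM : supported al (mnm_support M) (strand al M v).
  move=> b; rewrite mxE; case: ifP => [|_]; last by rewrite eqxx.
  by rewrite mesym1_le.
have zd : strand al M v *m aug_bd L = 0.
  rewrite -(strand_monbd aug_bd_lab) vD; apply/rowP=> b; rewrite !mxE mcoeff0.
  by case: ifP.
have [QM|nQM] := boolP (Q (mnm_support M)).
  have [w wM ->] := aug_bd_exact QM sM zd.
  by exists (assemble al M w); rewrite (assemble_mul aug_bd_lab).
(* Outside the ideal the only cell below M is the extra one, where the strand
   vanishes by hypothesis. *)
exists 0; rewrite mul0mx; apply/rowP=> b; rewrite [LHS]mxE [RHS]mxE.
suff -> : strand al M v 0 b = 0 by rewrite scale0r.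
have [-> //|nz] := eqVneq (strand al M v 0 b) 0.
have := sM b nz; clear nz; rewrite [strand _ _ _ _ _]mxE /aug_lab.
case: (split_ordP b) => {}b ->; last first.
  by rewrite row_mxEr => /(lab_up rL) QM; rewrite QM in nQM.
rewrite row_mxEl [const_mx _ _ _]mxE => _.
have -> : mesym1 set0 = 0%MM :> 'X_{1..m} by apply/mnmP=> i; rewrite !mnmE inE.
have -> : (M - 0 = M)%MM by apply/mnmP=> i; rewrite !mnmE subn0.
have -> : lshift (lsize L) b = 0 by apply/val_inj; rewrite /= (ord1 b).
by move/sqf_idealP: Jv => /(_ _ nQM) ->; rewrite if_same.
Qed.

Lemma monbd_image (w : 'rV[S]_N) : sqf_ideal Q ((w *m aug_monbd) 0 0).
Proof.
apply/sqf_idealP=> u nQ; rewrite mxE raddf_sum big1 // => b _.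
rewrite mxE /= -scalerAr mcoeffZ mcoeffMX_if.
have z0 : (0 : 'I_N) = lshift _ 0 by apply/val_inj.
have l0 : lam (0 : 'I_N) = 0%MM.
  by rewrite z0 /aug_lab row_mxEl mxE; apply/mnmP=> i; rewrite !mnmE inE.
have [->|nz] := eqVneq (aug_bd L b 0) 0; first by rewrite mul0r.
case: ifP => [|_]; last by rewrite mulr0.
have -> : (lam b - lam (0%R : 'I_N) = lam b)%MM.
  by rewrite l0; apply/mnmP=> i; rewrite !mnmE subn0.
rewrite mesym1_le; move: nz; rewrite /aug_lab.
case: (split_ordP b) => {}b ->; last first.
  by rewrite row_mxEr => _ /(lab_up rL) QM; rewrite QM in nQ.
by rewrite z0 /aug_bd block_mxEul mxE eqxx.
Qed.

End AugmentedComplex.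

(** * The resolution carried by a labelled complex *)

Section Selection.
Variables (R : comNzRingType) (n : nat) (A : {set 'I_n}).

Definition sel_mx : 'M[R]_(#|A|, n) := rowsub enum_val 1%:M.

Lemma sel_mxE (v : 'rV[R]_#|A|) b : b \notin A -> (v *m sel_mx) 0 b = 0.
Proof.
move=> hb; rewrite mxE big1 // => a _; rewrite !mxE.
case: eqP => [eab|_]; last by rewrite mulr0.
by move: (enum_valP a); rewrite eab (negbTE hb).
Qed.

Lemma sel_mx_tr : sel_mx *m sel_mx^T = 1%:M.
Proof.
apply/matrixP=> a b; rewrite !mxE (bigD1 (enum_val a)) //= !mxE eqxx mul1r big1 => [|c ne].
  by rewrite addr0 (inj_eq enum_val_inj) eq_sym.
by rewrite !mxE eq_sym (negbTE ne) mul0r.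
Qed.

Lemma sel_mx_enum_val (v : 'rV[R]_#|A|) a : (v *m sel_mx) 0 (enum_val a) = v 0 a.
Proof.
rewrite mxE (bigD1 a) //= !mxE eqxx mulr1 big1 ?addr0 // => c ne.
by rewrite !mxE (inj_eq enum_val_inj) (negbTE ne) mulr0.
Qed.

Lemma row_sel_mx_tr (v : 'rV[R]_n) a : (v *m sel_mx^T) 0 a = v 0 (enum_val a).
Proof.
rewrite mxE (bigD1 (enum_val a)) //= !mxE eqxx mulr1 big1 ?addr0 // => c ne.
by rewrite !mxE eq_sym (negbTE ne) mulr0.
Qed.

Lemma tr_sel_mx : sel_mx^T *m sel_mx = diag_mx (\row_b (b \in A)%:R).
Proof.
apply/row_matrixP => b; rewrite row_mul row_diag_mx; apply/rowP => c.
rewrite [RHS]mxE [delta_mx _ _ _ _]mxE [X in X * _]mxE.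
have [cA|cA] := boolP (c \in A); last first.
  rewrite sel_mxE // eqxx /=; case: eqP => [<-|_]; last by rewrite mulr0.
  by rewrite (negbTE cA) mul0r.
rewrite -(enum_rankK_in cA cA) sel_mx_enum_val !mxE enum_rankK_in //.
by rewrite eqxx /=; case: eqP => [<-|_]; rewrite ?cA ?mulr1 ?mulr0.
Qed.

End Selection.

Lemma rank_diag_indicator (K : fieldType) n (P : pred 'I_n) :
  \rank (diag_mx (\row_b (P b)%:R) : 'M[K]_n) = #|P|.
Proof.
have -> : \row_b (P b)%:R = \row_b (b \in [set b | P b])%:R :> 'rV[K]_n.
  by apply/rowP => b; rewrite !mxE inE.
have fE : row_free (sel_mx K [set b | P b]).
  by apply/row_freeP; exists (sel_mx K [set b | P b])^T; apply: sel_mx_tr.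
by rewrite -tr_sel_mx mxrankMfree // mxrank_tr (eqnP fE) cardsE.
Qed.

(** A differential D on a based module, homogeneous of degree -1 for the degree
h of the basis, is cut into its components between consecutive degrees. *)
Section GradedPieces.
Variables (R : comNzRingType) (n : nat) (h : 'I_n -> nat) (D : 'M[R]_n).
Hypothesis D_deg : forall b a, D b a != 0 -> h b = (h a).+1.

Definition level i := [set b | h b == i].

Notation level_mx i := (sel_mx R (level i)).

Definition level_bd i : 'M[R]_(#|level i.+1|, #|level i|) := mxsub enum_val enum_val D.

Lemma level_mx_bd i (v : 'rV[R]_#|level i.+1|) :
  (v *m level_mx i.+1) *m D = (v *m level_bd i) *m level_mx i.
Proof.
apply/rowP=> a; have [ha|ha] := eqVneq (h a) i; last first.
  rewrite sel_mxE ?inE // mxE big1 // => b _.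
  have [->|/D_deg hb] := eqVneq (D b a) 0; first by rewrite mulr0.
  by rewrite sel_mxE ?mul0r // inE hb eqSS.
have aL : a \in level i by rewrite inE ha.
rewrite -(enum_rankK_in aL aL) sel_mx_enum_val -mulmxA !mxE.
apply: eq_bigr => b _; rewrite !mxE (bigD1 (enum_val b)) //= !mxE eqxx mul1r big1 ?addr0 //.
by move=> c ne; rewrite !mxE eq_sym (negbTE ne) mul0r.
Qed.

Lemma level_mx0_bd (v : 'rV[R]_#|level 0|) : (v *m level_mx 0) *m D = 0.
Proof.
apply/rowP=> a; rewrite !mxE big1 // => b _.
have [->|/D_deg hb] := eqVneq (D b a) 0; first by rewrite mulr0.
by rewrite sel_mxE ?mul0r // inE hb.
Qed.

Lemma bd_level_mx i (w : 'rV[R]_n) :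
  (w *m D) *m (level_mx i)^T = (w *m (level_mx i.+1)^T) *m level_bd i.
Proof.
apply/rowP=> a; rewrite row_sel_mx_tr !mxE.
rewrite [RHS](eq_bigr (fun b => w 0 (enum_val b) * D (enum_val b) (enum_val a))); last first.
  by move=> b _; rewrite row_sel_mx_tr [level_bd _ _ _]mxE.
rewrite -(@big_enum_val _ _ _ _ (mem (level i.+1)) (fun b => w 0 b * D b (enum_val a))) /=.
rewrite [LHS](bigID (mem (level i.+1))) /= [X in _ + X]big1 ?addr0 // => b.
rewrite inE; have [->|/D_deg ->] := eqVneq (D b (enum_val a)) 0; first by rewrite mulr0.
by have := enum_valP a; rewrite inE => /eqP ->; rewrite eqxx.
Qed.

End GradedPieces.

Section Resolution.
Variables (K : fieldType) (m : nat) (L : labelled_complex K m).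
Variables (A : {set 'I_m}) (Q : {set 'I_m} -> bool).
Hypotheses (rL : resolves L A Q) (Q0 : ~~ Q set0).
Variable J : {mpoly K[m]} -> Prop.
Hypothesis JQ : forall f, J f <-> sqf_ideal Q f.
Notation S := {mpoly K[m]}.
Notation N := (1 + lsize L)%N.
Notation al := (fun b => aug_lab L 0 b).
Notation ah := (fun b => aug_hdeg L 0 b).
Notation D := (monbd al (aug_bd L)).

Lemma monbd_deg b a : D b a != 0 -> ah b = (ah a).+1.
Proof.
rewrite mxE; have [->|/(aug_bd_supp rL Q0)[-> //]] := eqVneq (aug_bd L b a) 0.
by rewrite scale0r eqxx.
Qed.

Definition res_rk i := #|level ah i|.
Definition res_gdeg i (b : 'I_(res_rk i)) : nat := #|al (enum_val b)|.
(** The cell 0 is the only one of degree 0, so this is the identity of the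
polynomial ring. *)
Definition res_aug : 'cV[S]_(res_rk 0) := col 0 (sel_mx S (level ah 0)).

Lemma res_augE (v : 'rV[S]_(res_rk 0)) : (v *m res_aug) 0 0 = (v *m sel_mx S (level ah 0)) 0 0.
Proof. by rewrite /res_aug colE mulmxA -colE mxE. Qed.

Lemma aug_hdeg0 : ah 0 = 0%N.
Proof.
have -> : (0 : 'I_N) = lshift _ 0 by apply/val_inj.
by rewrite /aug_hdeg row_mxEl mxE.
Qed.

Lemma aug_lab0 : al 0 = set0.
Proof.
have -> : (0 : 'I_N) = lshift _ 0 by apply/val_inj.
by rewrite /aug_lab row_mxEl mxE.
Qed.

Lemma res_diff_homog i b a (u : 'X_{1..m}) :
    u \in msupp (level_bd ah D i b a) -> (mdeg u + res_gdeg a)%N = res_gdeg b.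
Proof.
rewrite mcoeff_msupp [level_bd _ _ _ _ _]mxE [D _ _]mxE mcoeffZ mcoeffX.
have [->|nz] := eqVneq (aug_bd L (enum_val b) (enum_val a)) 0; first by rewrite mul0r eqxx.
case: (_ =P u) => [<-|_]; last by rewrite mulr0 eqxx.
rewrite -[res_gdeg a]mdeg_mesym1 -mdegD.
by rewrite submK ?(mesym1_lab_le (aug_bd_lab rL Q0) nz) // mdeg_mesym1.
Qed.

Lemma res_aug_homog a (u : 'X_{1..m}) : u \in msupp (res_aug a ord0) -> mdeg u = res_gdeg a.
Proof.
rewrite !mxE /res_gdeg; case: eqP => [->|_]; last by rewrite msupp0.
by rewrite msupp1 inE aug_lab0 cards0 => /eqP ->; rewrite mdeg0.
Qed.

Lemma res_aug_onto (f : S) : exists v : 'rV_(res_rk 0), J (f - (v *m res_aug) ord0 ord0).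
Proof.
exists ((\row_b (f *+ (b == 0))) *m (sel_mx S (level ah 0))^T).
have L0 : (0 : 'I_N) \in level ah 0 by rewrite inE aug_hdeg0.
rewrite JQ res_augE -{2}(enum_rankK_in L0 L0) sel_mx_enum_val row_sel_mx_tr mxE enum_rankK_in //.
by rewrite subrr; apply: sqf_ideal0.
Qed.

Lemma res_exact_0 (v : 'rV_(res_rk 0)) :
    J ((v *m res_aug) ord0 ord0) <-> exists w, v = w *m level_bd ah D 0.
Proof.
rewrite JQ res_augE; split=> [Jv|[w ->]].
  have [w Dw] := monbd_exact rL Q0 Jv (level_mx0_bd monbd_deg v).
  exists (w *m (sel_mx S (level ah 1))^T).
  by rewrite -(bd_level_mx monbd_deg) -Dw -mulmxA sel_mx_tr mulmx1.
by rewrite -(level_mx_bd monbd_deg); apply: (monbd_image rL).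
Qed.

Lemma res_exact_S i (v : 'rV_(res_rk i.+1)) :
  v *m level_bd ah D i = 0 <-> exists w, v = w *m level_bd ah D i.+1.
Proof.
split=> [vD|[w ->]].
  have vD0 : v *m sel_mx S (level ah i.+1) *m D = 0.
    by rewrite (level_mx_bd monbd_deg) vD mul0mx.
  have Jv : sqf_ideal Q ((v *m sel_mx S (level ah i.+1)) 0 0).
    by rewrite sel_mxE ?inE ?aug_hdeg0 //; apply: sqf_ideal0.
  have [w Dw] := monbd_exact rL Q0 Jv vD0.
  exists (w *m (sel_mx S (level ah i.+2))^T).
  by rewrite -(bd_level_mx monbd_deg) -Dw -mulmxA sel_mx_tr mulmx1.
have inj (z : 'rV[S]_(res_rk i)) : z = z *m sel_mx S (level ah i) *m (sel_mx S (level ah i))^T.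
  by rewrite -mulmxA sel_mx_tr mulmx1.
rewrite [LHS]inj -!(level_mx_bd monbd_deg) -mulmxA.
by rewrite (monbd_monbd (aug_bd_lab rL Q0) (aug_bd_aug_bd rL)) mulmx0 mul0mx.
Qed.

Definition cell_resolution : graded_resolution J :=
  GradedResolution res_diff_homog res_aug_homog res_aug_onto res_exact_0 res_exact_S.

(** Minimality: the labels at a nonzero entry are different, so the entry is a
multiple of a variable. *)
Lemma cell_resolution_minimal i : diffK cell_resolution i = 0.
Proof.
apply/matrixP=> b a; rewrite [LHS]mxE [diff _ _ _ _]mxE [D _ _]mxE [RHS]mxE mcoeffZ mcoeffX.
have [->|/(aug_bd_supp rL Q0)[_ lt_ab]] := eqVneq (aug_bd L (enum_val b) (enum_val a)) 0.
  by rewrite mul0r.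
case: eqP => [e0|]; last by rewrite mulr0.
have := proper_card lt_ab; rewrite -!mdeg_mesym1.
by rewrite -(submK (mesym1_leS (proper_sub lt_ab))) e0 add0m ltnn.
Qed.

Lemma tor_dim_cell_resolution i j :
  tor_dim cell_resolution i j = #|[set b | (ah b == i) && (#|al b| == j)]|.
Proof.
rewrite /tor_dim /boundaries cell_resolution_minimal mulmx0 mxrank0 subn0.
have -> : \rank (cycles cell_resolution i j) = \rank (degree_part cell_resolution i j).
  case: i => //= i; rewrite cell_resolution_minimal.
  by apply: eqmx_rank; rewrite capmxSl sub_capmx submx_refl sub_kermx mulmx0 eqxx.
rewrite rank_diag_indicator -[RHS]sum1_card.
rewrite (eq_bigl (fun b => (b \in level ah i) && (#|al b| == j))); last first.
  by move=> b; rewrite !inE.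
rewrite big_mkcondr /=.
rewrite (@big_enum_val _ _ _ _ (mem (level ah i))
           (fun b => if #|al b| == j then 1%N else 0%N)) /=.
by rewrite -big_mkcond /= sum1_card.
Qed.

End Resolution.

(** * Homogeneous parts and subquotients *)

(** Dependent choice: P says that the construction can go on. *)
Lemma dependent_sequence (T : nat -> Type) (P : forall i, T i -> Prop)
    (R : forall i, T i -> T i.+1 -> Prop) (x0 : T 0%N) :
  P 0%N x0 -> (forall i x, P i x -> exists2 y, R i x y & P i.+1 y) ->
  exists f : forall i, T i, f 0%N = x0 /\ forall i, R i (f i) (f i.+1).
Proof.
move=> P0 step.
have next i (x : {x : T i | P i x}) : {y : {y : T i.+1 | P i.+1 y} | R i (sval x) (sval y)}.
  case: x => x Px; apply: constructive_indefinite_description.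
  by have [y Rxy Py] := step i x Px; exists (exist _ y Py).
pose f := fix f i : {x : T i | P i x} :=
  if i is i'.+1 then sval (next i' (f i')) else exist _ x0 P0.
by exists (fun i => sval (f i)); split=> // i; apply: (svalP (next i (f i))).
Qed.

(** If phi maps Z to Z', psi maps B' to B and their composite is the identity of
Z modulo B, then phi induces an injection of Z / B into Z' / B'. *)
Lemma rank_subquotient_le (K : fieldType) n n' p p' q q'
    (Z : 'M[K]_(p, n)) (B : 'M[K]_(q, n)) (Z' : 'M[K]_(p', n')) (B' : 'M[K]_(q', n'))
    (phi : 'M[K]_(n, n')) (psi : 'M[K]_(n', n)) :
  (Z *m phi <= Z')%MS -> (B' <= Z')%MS -> (B' *m psi <= B)%MS ->
  (Z *m (phi *m psi - 1%:M) <= B)%MS ->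
  (\rank Z - \rank B <= \rank Z' - \rank B')%N.
Proof.
move=> Zphi BZ' B'psi ZB; set W := (Z :\: B)%MS.
have WZ : (W <= Z)%MS by apply: diffmxSl.
have W0 (u : 'rV_n) : (u <= W)%MS -> (u *m phi <= B')%MS -> u = 0.
  move=> uW uB; apply/eqP; rewrite -submx0 -(capmx_diff Z B) sub_capmx uW /=.
  have -> : u = u *m phi *m psi - u *m (phi *m psi - 1%:M).
    by rewrite mulmxBr mulmx1 mulmxA subKr.
  rewrite addmx_sub ?eqmx_opp //; first exact: submx_trans (submxMr _ uB) B'psi.
  exact: submx_trans (submxMr _ (submx_trans uW WZ)) ZB.
have rkW : \rank (W *m phi) = \rank W.
  apply/mxrank_injP/rowV0P => u; rewrite sub_capmx => /andP[uW /sub_kermxP u0].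
  by apply: W0 => //; rewrite u0 sub0mx.
have dir : (W *m phi :&: B')%MS == 0.
  apply/rowV0P => u; rewrite sub_capmx => /andP[/submxP[x ->] uB].
  by rewrite mulmxA (W0 (x *m W)) ?mul0mx ?submxMl // -mulmxA.
have : (\rank (W *m phi + B')%MS <= \rank Z')%N.
  by apply: mxrankS; rewrite addsmx_sub BZ' andbT (submx_trans (submxMr _ WZ)).
rewrite mxrank_disjoint_sum ?(eqP dir) // rkW => le_rk.
have := mxrank_cap_compl Z B; rewrite -/W => rkZ.
have le_cap : (\rank (Z :&: B)%MS <= \rank B)%N by rewrite mxrankS ?capmxSr.
by rewrite leq_subLR -rkZ leq_add // leq_subRL ?mxrankS // addnC.
Qed.

Section HomogeneousPart.
Variables (K : fieldType) (m : nat).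
Notation S := {mpoly K[m]}.

Lemma mcoeff_pihomog d (p : S) u :
  (pihomog mdeg d p)@_u = if mdeg u == d then p@_u else 0.
Proof.
rewrite pihomogE raddf_sum /= -big_filter.
have [uv|nuv] := boolP (u \in [seq u <- msupp p | mdeg u == d]).
  rewrite (bigD1_seq u) ?filter_uniq ?msupp_uniq //= mcoeffZ mcoeffX eqxx mulr1.
  rewrite big1 => [|v /negbTE ne]; last by rewrite mcoeffZ mcoeffX ne mulr0.
  by rewrite addr0; move: uv; rewrite mem_filter => /andP[-> _].
rewrite big_seq big1 => [|v vs]; last first.
  by rewrite mcoeffZ mcoeffX; case: (v =P u) vs nuv => [-> -> //|]; rewrite mulr0.
by case: ifP => // ud; rewrite mem_filter ud /= in nuv; rewrite (memN_msupp_eq0 nuv).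
Qed.

(** The component of degree b - a, which is zero when b < a.  It is the part
that an entry of a homogeneous map may have between generators of degrees b
and a. *)
Definition hpart (a b : nat) (p : S) : S := if (a <= b)%N then pihomog mdeg (b - a) p else 0.

Lemma mcoeff_hpart a b p u :
  (hpart a b p)@_u = if (mdeg u + a == b)%N then p@_u else 0.
Proof.
rewrite /hpart; case: leqP => [le_ab|lt_ba].
  by rewrite mcoeff_pihomog -[in RHS](subnK le_ab) eqn_add2r.
by rewrite mcoeff0; case: eqP => // eb; rewrite -eb ltnNge leq_addl in lt_ba.
Qed.

Definition homogeneous_mx p q (g : 'I_p -> nat) (g' : 'I_q -> nat) (M : 'M[S]_(p, q)) :=
  forall b a u, u \in msupp (M b a) -> (mdeg u + g' a)%N = g b.

Definition hpart_mx p q (g : 'I_p -> nat) (g' : 'I_q -> nat) (M : 'M[S]_(p, q)) : 'M[S]_(p, q) :=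
  \matrix_(b, a) hpart (g' a) (g b) (M b a).

Lemma hpart_mx_homogeneous p q g g' (M : 'M[S]_(p, q)) :
  homogeneous_mx g g' (hpart_mx g g' M).
Proof.
move=> b a u; rewrite mxE mcoeff_msupp mcoeff_hpart.
by case: (_ =P g b) => //; rewrite eqxx.
Qed.

Lemma hpart_mx_id p q g g' (M : 'M[S]_(p, q)) :
  homogeneous_mx g g' M -> hpart_mx g g' M = M.
Proof.
move=> hM; apply/matrixP=> b a; apply/mpolyP=> u; rewrite mxE mcoeff_hpart.
case: (_ =P g b) => // ne; apply/esym/memN_msupp_eq0.
by apply/negP => /hM.
Qed.

Lemma hpart_mull a b c (p d : S) :
  (forall u, u \in msupp d -> (mdeg u + c)%N = a) ->
  hpart c b (p * d) = hpart a b p * d.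
Proof.
move=> hd; apply/mpolyP=> u; rewrite mcoeff_hpart !mcoeffM.
have split k : u == (k.1 + k.2)%MM :> 'X_{1..m} -> d@_k.2 != 0 ->
    (mdeg u + c == b)%N = (mdeg k.1 + a == b)%N.
  by move=> /eqP ->; rewrite -mcoeff_msupp mdegD => /hd <-; rewrite addnA.
case: ifP => ub.
  apply: eq_bigr => k uk; rewrite mcoeff_hpart.
  have [->|nz] := eqVneq (d@_k.2) 0; first by rewrite !mulr0.
  by rewrite -(split (bmnm k.1, bmnm k.2) uk nz) ub.
rewrite big1 // => k uk; rewrite mcoeff_hpart.
have [->|nz] := eqVneq (d@_k.2) 0; first by rewrite !mulr0.
by rewrite -(split (bmnm k.1, bmnm k.2) uk nz) ub mul0r.
Qed.

Lemma hpart_mulr a b c (p d : S) :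
  (forall u, u \in msupp d -> (mdeg u + a)%N = b) ->
  hpart c b (d * p) = d * hpart c a p.
Proof.
move=> hd; apply/mpolyP=> u; rewrite mcoeff_hpart !mcoeffM.
have split k : u == (k.1 + k.2)%MM :> 'X_{1..m} -> d@_k.1 != 0 ->
    (mdeg u + c == b)%N = (mdeg k.2 + c == a)%N.
  by move=> /eqP ->; rewrite -mcoeff_msupp mdegD => /hd <-; rewrite -addnA eqn_add2l.
case: ifP => ub.
  apply: eq_bigr => k uk; rewrite mcoeff_hpart.
  have [->|nz] := eqVneq (d@_k.1) 0; first by rewrite !mul0r.
  by rewrite -(split (bmnm k.1, bmnm k.2) uk nz) ub.
rewrite big1 // => k uk; rewrite mcoeff_hpart.
have [->|nz] := eqVneq (d@_k.1) 0; first by rewrite !mul0r.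
by rewrite -(split (bmnm k.1, bmnm k.2) uk nz) ub mulr0.
Qed.

Lemma hpart_sum a b I (r : seq I) (F : I -> S) :
  hpart a b (\sum_(i <- r) F i) = \sum_(i <- r) hpart a b (F i).
Proof.
by rewrite /hpart; case: leqP => _; rewrite ?raddf_sum // big1.
Qed.

Lemma hpart_mx_mull p q r g g' g'' (M : 'M[S]_(p, q)) (D : 'M[S]_(q, r)) :
  homogeneous_mx g' g'' D -> hpart_mx g g'' (M *m D) = hpart_mx g g' M *m D.
Proof.
move=> hD; apply/matrixP=> b c; rewrite !mxE hpart_sum; apply: eq_bigr => a _.
by rewrite mxE; apply: hpart_mull; apply: hD.
Qed.

Lemma hpart_mx_mulr p q r g g' g'' (M : 'M[S]_(q, r)) (D : 'M[S]_(p, q)) :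
  homogeneous_mx g g' D -> hpart_mx g g'' (D *m M) = D *m hpart_mx g' g'' M.
Proof.
move=> hD; apply/matrixP=> b c; rewrite !mxE hpart_sum; apply: eq_bigr => a _.
by rewrite mxE; apply: hpart_mulr; apply: hD.
Qed.

Lemma hpart_mxB p q g g' (M M' : 'M[S]_(p, q)) :
  hpart_mx g g' (M - M') = hpart_mx g g' M - hpart_mx g g' M'.
Proof.
apply/matrixP=> b a; rewrite !mxE /hpart; case: leqP => _; last by rewrite subr0.
exact: pihomogB.
Qed.

Definition mod_vars p q (M : 'M[S]_(p, q)) : 'M[K]_(p, q) := map_mx (mcoeff 0%MM) M.

Lemma mod_varsM p q r (M : 'M[S]_(p, q)) (M' : 'M[S]_(q, r)) :
  mod_vars (M *m M') = mod_vars M *m mod_vars M'.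
Proof. exact: map_mxM. Qed.

(** Modulo the variables a homogeneous map preserves degrees. *)
Lemma mod_vars_degree p q (g : 'I_p -> nat) (g' : 'I_q -> nat) M j : homogeneous_mx g g' M ->
  diag_mx (\row_b (g b == j)%:R) *m mod_vars M = mod_vars M *m diag_mx (\row_b (g' b == j)%:R).
Proof.
move=> hM; apply/matrixP=> b a; rewrite mul_diag_mx mul_mx_diag !mxE.
have [->|nz] := eqVneq ((M b a)@_0) 0; first by rewrite mul0r mulr0.
have := hM b a 0%MM; rewrite mcoeff_msupp mdeg0 add0n => -> //.
by rewrite mulrC.
Qed.

End HomogeneousPart.

(** * Independence of Tor from the resolution *)

Record homogeneous_ideal (K : fieldType) m (J : {mpoly K[m]} -> Prop) : Prop :=
  HomogeneousIdeal {
    ideal0 : J 0;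
    idealD : forall f g, J f -> J g -> J (f + g);
    idealM : forall f g, J g -> J (f * g);
    ideal_pihomog : forall d f, J f -> J (pihomog mdeg d f)
  }.

Lemma sqf_homogeneous_ideal (K : fieldType) m (J : {mpoly K[m]} -> Prop)
    (Q : {set 'I_m} -> bool) :
  (forall U V : {set 'I_m}, U \subset V -> Q U -> Q V) ->
  (forall f, J f <-> sqf_ideal Q f) -> homogeneous_ideal J.
Proof.
move=> Qup JQ; split=> [|f g|f g|d f]; rewrite !JQ.
- exact: sqf_ideal0.
- by move=> Jf Jg u /msuppD_le; rewrite mem_cat => /orP[/Jf|/Jg].
- move=> Jg u /msuppM_le /allpairsP[[v w] /= [_ /Jg Qw ->]].
  apply: Qup Qw; apply: mnm_supportS; apply/mnm_lepP => i.
  by rewrite mnmDE leq_addl.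
move=> Jf u; rewrite mcoeff_msupp mcoeff_pihomog; case: ifP => [_|_ /eqP//].
by rewrite -mcoeff_msupp => /Jf.
Qed.

Section Comparison.
Variables (K : fieldType) (m : nat) (J : {mpoly K[m]} -> Prop).
Hypothesis hJ : homogeneous_ideal J.
Notation S := {mpoly K[m]}.
Implicit Types F G : graded_resolution J.

Definition gdeg_in F i : 'I_(rk F i) -> nat := @gdeg _ _ _ F i.

Definition col_in_ideal p (M : 'cV[S]_p) := forall a, J (M a 0).

Lemma col_in_idealD p (M M' : 'cV[S]_p) :
  col_in_ideal M -> col_in_ideal M' -> col_in_ideal (M + M').
Proof. by move=> h h' a; rewrite mxE; apply: (idealD hJ). Qed.

Lemma col_in_idealM p q (X : 'M[S]_(p, q)) (M : 'cV[S]_q) :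
  col_in_ideal M -> col_in_ideal (X *m M).
Proof.
move=> h a; rewrite mxE; elim/big_ind: _ => [|f g Jf Jg|b _]; first exact: (ideal0 hJ).
  exact: (idealD hJ).
exact: (idealM hJ).
Qed.

Lemma col_in_idealN p (M : 'cV[S]_p) : col_in_ideal M -> col_in_ideal (- M).
Proof. by move=> h; rewrite -[M]mul1mx -mulNmx; apply: col_in_idealM. Qed.

Lemma col_in_ideal_hpart p (g : 'I_p -> nat) (M : 'cV[S]_p) :
  col_in_ideal M -> col_in_ideal (hpart_mx g (fun=> 0%N) M).
Proof.
by move=> h a; rewrite mxE /hpart leq0n; apply: (ideal_pihomog hJ).
Qed.

Lemma diff_homogeneous F i : homogeneous_mx (@gdeg_in F i.+1) (@gdeg_in F i) (diff F i).
Proof. by move=> b a u; apply: diff_homog. Qed.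

Lemma aug_homogeneous F : homogeneous_mx (@gdeg_in F 0) (fun=> 0%N) (aug F).
Proof. by move=> b a u; rewrite [a]ord1 => /aug_homog; rewrite addn0. Qed.

Lemma lift_aug F G : exists X : 'M[S]_(rk F 0, rk G 0), col_in_ideal (aug F - X *m aug G).
Proof.
have /fin_all_exists[v vP] : forall a, exists v : 'rV_(rk G 0),
    J (aug F a 0 - (v *m aug G) 0 0) by move=> a; apply: aug_onto.
exists (\matrix_a v a) => a; rewrite !mxE; have := vP a; rewrite !mxE.
by congr J; congr (_ - _); apply: eq_bigr => b _; rewrite !mxE.
Qed.

(** Free modules are projective: maps into the kernels of a resolution lift,
one row at a time. *)
Lemma lift_0 G p (X : 'M[S]_(p, rk G 0)) :
  col_in_ideal (X *m aug G) -> exists Y, X = Y *m diff G 0.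
Proof.
move=> JX; have /fin_all_exists[w wP] : forall a, exists w, row a X = w *m diff G 0.
  move=> a; apply/(exact_0 (row a X)).
  by rewrite -row_mul mxE; apply: JX.
exists (\matrix_a w a); apply/row_matrixP => a.
by rewrite row_mul rowK wP.
Qed.

Lemma lift_S G i p (X : 'M[S]_(p, rk G i.+1)) :
  X *m diff G i = 0 -> exists Y, X = Y *m diff G i.+1.
Proof.
move=> dX; have /fin_all_exists[w wP] : forall a, exists w, row a X = w *m diff G i.+1.
  by move=> a; apply/(exact_S (row a X)); rewrite -row_mul dX row0.
exists (\matrix_a w a); apply/row_matrixP => a.
by rewrite row_mul rowK wP.
Qed.

Lemma diff_diff F i : diff F i.+1 *m diff F i = 0.
Proof.
apply/row_matrixP=> b; rewrite row_mul row0; apply/exact_S.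
by exists (delta_mx 0 b); rewrite -rowE.
Qed.

Lemma diff_aug F : col_in_ideal (diff F 0 *m aug F).
Proof.
move=> b; have : J ((row b (diff F 0) *m aug F) 0 0).
  by apply/exact_0; exists (delta_mx 0 b); rewrite -rowE.
by rewrite -row_mul mxE.
Qed.

(** Any lift of the identity of S / J to a chain map can be made homogeneous
afterwards, since taking homogeneous parts commutes with multiplication by the
homogeneous differentials. *)
Lemma chain_map F G : exists phi : forall i, 'M[S]_(rk F i, rk G i),
  [/\ forall i, homogeneous_mx (@gdeg_in F i) (@gdeg_in G i) (phi i),
      col_in_ideal (aug F - phi 0%N *m aug G)
    & forall i, diff F i *m phi i = phi i.+1 *m diff G i].
Proof.
have [X0 X0P] := lift_aug F G.
have [|i X [Y eY]|f [f0 fS]] := @dependent_sequence (fun i => 'M[S]_(rk F i, rk G i))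
   (fun i X => exists Y, diff F i *m X = Y *m diff G i)
   (fun i X Y => diff F i *m X = Y *m diff G i) X0.
- apply: lift_0; rewrite -mulmxA.
  have -> : diff F 0 *m (X0 *m aug G) =
     diff F 0 *m aug F - diff F 0 *m (aug F - X0 *m aug G) by rewrite mulmxBr subKr.
  by apply: col_in_idealD; [exact: diff_aug | apply/col_in_idealN/col_in_idealM].
- by exists Y => //; apply: lift_S; rewrite -mulmxA -eY mulmxA diff_diff mul0mx.
exists (fun i => hpart_mx (@gdeg_in F i) (@gdeg_in G i) (f i)); split=> [i||i].
- exact: hpart_mx_homogeneous.
- rewrite -(hpart_mx_mull _ _ (@aug_homogeneous G)).
  rewrite -[aug F](hpart_mx_id (@aug_homogeneous F)) -hpart_mxB f0.
  exact: col_in_ideal_hpart.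
rewrite -(hpart_mx_mulr _ _ (@diff_homogeneous F i)) fS.
by rewrite -(hpart_mx_mull _ _ (@diff_homogeneous G i)).
Qed.

Lemma null_homotopy F (theta : forall i, 'M[S]_(rk F i)) :
  col_in_ideal (aug F - theta 0%N *m aug F) ->
  (forall i, diff F i *m theta i = theta i.+1 *m diff F i) ->
  exists h : forall i, 'M[S]_(rk F i, rk F i.+1),
    theta 0%N - 1%:M = h 0%N *m diff F 0 /\
    forall i, theta i.+1 - 1%:M = h i.+1 *m diff F i.+1 + diff F i *m h i.
Proof.
move=> th0 thS.
have [|X0 X0P] := @lift_0 F _ (theta 0%N - 1%:M).
  by rewrite mulmxBl mul1mx -opprB; apply: col_in_idealN.
have [|i X [Y eY]|f [f0 fS]] := @dependent_sequence (fun i => 'M[S]_(rk F i, rk F i.+1))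
   (fun i X => exists Y, theta i.+1 - 1%:M - diff F i *m X = Y *m diff F i.+1)
   (fun i X Y => theta i.+1 - 1%:M - diff F i *m X = Y *m diff F i.+1) X0.
- apply: lift_S; rewrite !mulmxBl mul1mx -mulmxA -X0P mulmxBr mulmx1 thS.
  by rewrite subrr.
- exists Y => //; apply: lift_S; rewrite !mulmxBl mul1mx -[diff F i.+1 *m Y *m _]mulmxA -eY.
  by rewrite !mulmxBr mulmx1 thS mulmxA diff_diff mul0mx subr0 subrr.
by exists f; split=> [|i]; [rewrite f0 | rewrite -fS subrK].
Qed.

(** Chain maps back and forth, whose composite is homotopic to the identity,
induce an injection on Tor in each degree. *)
Lemma tor_dim_le F G i j : (tor_dim F i j <= tor_dim G i j)%N.
Proof.
have [phi [phi_hom phi0 phiS]] := chain_map F G.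
have [psi [psi_hom psi0 psiS]] := chain_map G F.
have [||h [h0 hS]] := @null_homotopy F (fun i => phi i *m psi i).
- have -> : aug F - phi 0%N *m psi 0%N *m aug F =
     aug F - phi 0%N *m aug G + phi 0%N *m (aug G - psi 0%N *m aug F).
    by rewrite mulmxBr addrA subrK mulmxA.
  by apply: col_in_idealD => //; apply: col_in_idealM.
- by move=> l; rewrite mulmxA phiS -!mulmxA psiS.
have degK H H' l (X : 'M[S]_(rk H l, rk H' l)) :
    homogeneous_mx (@gdeg_in H l) (@gdeg_in H' l) X ->
    degree_part H l j *m mod_vars X = mod_vars X *m degree_part H' l j.
  exact: mod_vars_degree.
have degd (H : graded_resolution J) l :
    degree_part H l.+1 j *m diffK H l = diffK H l *m degree_part H l j.
  exact: (mod_vars_degree j (@diff_homogeneous H l)).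
have dd (H : graded_resolution J) l : diffK H l.+1 *m diffK H l = 0.
  by rewrite -[LHS]mod_varsM diff_diff /mod_vars map_mx0.
have phidK l : diffK F l *m mod_vars (phi l) = mod_vars (phi l.+1) *m diffK G l.
  by rewrite -!mod_varsM phiS.
have psidK l : diffK G l *m mod_vars (psi l) = mod_vars (psi l.+1) *m diffK F l.
  by rewrite -!mod_varsM psiS.
have degid (H : graded_resolution J) l :
    degree_part H l j *m degree_part H l j = degree_part H l j.
  apply/matrixP=> b a; rewrite mul_diag_mx !mxE.
  by case: (_ == j); rewrite ?mul1r // mul0r mul0rn.
have cyc_deg (H : graded_resolution J) l : (cycles H l j <= degree_part H l j)%MS.
  by case: l => [|l] //=; apply: capmxSl.
apply: (@rank_subquotient_le _ _ _ _ _ _ _ _ _ _ _ (mod_vars (phi i)) (mod_vars (psi i))).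
- case: i => [|i] /=; first by rewrite (degK _ _ _ _ (phi_hom 0%N)) submxMl.
  rewrite sub_capmx; apply/andP; split.
    apply: submx_trans (submxMr _ (capmxSl _ _)) _.
    by rewrite (degK _ _ _ _ (phi_hom i.+1)) submxMl.
  apply/sub_kermxP; rewrite -mulmxA -phidK mulmxA.
  by have /sub_kermxP -> := capmxSr (degree_part F i.+1 j) (kermx (diffK F i)); rewrite mul0mx.
- rewrite /boundaries degd; case: i => [|i] /=; first exact: submxMl.
  by rewrite sub_capmx submxMl /= -degd; apply/sub_kermxP; rewrite -mulmxA dd mulmx0.
- rewrite /boundaries -mulmxA psidK mulmxA (degK _ _ _ _ (psi_hom i.+1)) -mulmxA.
  exact: submxMl.
set Theta := mod_vars (phi i) *m mod_vars (psi i) - 1%:M.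
have ThetaE : Theta = mod_vars (phi i *m psi i - 1%:M).
  by rewrite /mod_vars raddfB /= map_mxM map_mx1.
have degTheta : degree_part F i j *m Theta = Theta *m degree_part F i j.
  rewrite mulmxBr mulmxBl mulmx1 mul1mx mulmxA (degK _ _ _ _ (phi_hom i)).
  by rewrite -!mulmxA (degK _ _ _ _ (psi_hom i)).
have cycTheta : cycles F i j *m Theta = cycles F i j *m mod_vars (h i) *m diffK F i.
  rewrite ThetaE; case: i => [|i] in Theta ThetaE degTheta *.
    by rewrite h0 mod_varsM mulmxA.
  rewrite hS /mod_vars raddfD /= !map_mxM mulmxDr !mulmxA.
  have /sub_kermxP -> : (cycles F i.+1 j <= kermx (diffK F i))%MS by apply: capmxSr.
  by rewrite mul0mx addr0.
have cycD : cycles F i j *m degree_part F i j = cycles F i j.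
  by have /submxP[X ->] := cyc_deg F i; rewrite -mulmxA degid.
(* Projecting to degree j on the right makes up for the missing homogeneity of
   the homotopy, because Theta and the differential preserve degrees. *)
have -> : cycles F i j *m Theta = cycles F i j *m mod_vars (h i) *m boundaries F i j.
  by rewrite -cycD -mulmxA degTheta mulmxA cycTheta /boundaries degd !mulmxA cycD.
exact: submxMl.
Qed.

Lemma betti_tor_dim F i j : betti J i j = tor_dim F i j.
Proof.
have [G ->] : exists G, betti J i j = tor_dim G i j.
  apply: (epsilon_spec (inhabits 0%N)
    (fun b => exists G : graded_resolution J, b = tor_dim G i j)).
  by exists (tor_dim F i j), F.
by apply/eqP; rewrite eqn_leq !tor_dim_le.
Qed.

End Comparison.

(** * Cuts of the tree in terms of words *)

Section WordCuts.
Variables (k m : nat).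
Implicit Types (n : nat) (f : seq 'I_k -> 'I_m) (U : {set 'I_m}).

(** An edge of the tree is named by the nonempty word of its lower vertex, and
f sends these words to variables.  The set U is a cut if in each subtree at the
root it contains the first edge or cuts the rest. *)
Fixpoint word_cut n f U : bool :=
  if n is n'.+1 then
    [forall i, (f [:: i] \in U) || word_cut n' (fun w => f (i :: w)) U]
  else false.

Fixpoint word_vars n f : {set 'I_m} :=
  if n is n'.+1 then
    \bigcup_i (f [:: i] |: word_vars n' (fun w => f (i :: w)))
  else set0.

(** The generating function of the cells of the resolution of the ideal; the
Betti numbers of the quotient ring are shifted by one homological degree. *)
Fixpoint cut_cells n : {poly {poly int}} :=
  if n is n'.+1 then
    (cut_cells n' + 'X%:P + 'X%:P * 'X * cut_cells n') ^+ k
  else 0.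

Lemma mem_word_vars n f x :
  reflect (exists2 w, (0 < size w <= n)%N & f w = x) (x \in word_vars n f).
Proof.
elim: n f => [|n IH] f /=.
  by rewrite inE; constructor => -[w /andP[w0]]; rewrite leqNgt w0.
apply: (iffP bigcupP) => [[i _]|[[//|i w] /= sw fw]].
  rewrite !inE => /orP[/eqP ->|/IH[w /andP[_ sw] <-]]; first by exists [:: i].
  by exists (i :: w).
exists i => //; rewrite !inE; case: w sw fw => [|i' w] sw fw; first by rewrite fw eqxx.
by apply/orP; right; apply/IH; exists (i' :: w).
Qed.

(** A tree without branches would have an empty cut in positive depth. *)
Lemma word_cut0 n f : (0 < k)%N -> ~~ word_cut n f set0.
Proof.
move=> k0; elim: n f => //= n IH f; apply/forallPn; exists (Ordinal k0).
by rewrite inE; apply: IH.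
Qed.

Lemma word_cutP n f U :
  word_cut n f U <-> forall w, size w = n -> has (fun j => f (take j.+1 w) \in U) (iota 0 n).
Proof.
elim: n f => [|n IH] f /=; first by split=> // /(_ [::] erefl).
have hasS i w : has (fun j => f (take j.+1 (i :: w)) \in U) (iota 1 n)
              = has (fun j => f (i :: take j.+1 w) \in U) (iota 0 n).
  by rewrite (iotaDl 1 0) has_map; apply: eq_has => j /=.
split=> [/forallP cut [//|i w] [sw]|hcut].
  rewrite /= take0; have /orP[-> //|/IH/(_ w sw) hw] := cut i.
  by rewrite -hasS in hw; rewrite hw orbT.
apply/forallP => i; have [//|nU /=] := boolP (f [:: i] \in U).
apply/IH => w sw; have := hcut (i :: w); rewrite /= sw take0 (negbTE nU) /= hasS.
exact.
Qed.

(** The recursion of the theorem: a cone over each subtree at the root, then the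
tensor product of the k cones. *)
Lemma resolvable_word_cut (K : fieldType) n f : (0 < k)%N ->
  {in [pred w | 0 < size w <= n]%N &, injective f} ->
  resolvable K (word_vars n f) (word_cut n f) (cut_cells n).
Proof.
move=> k0; elim: n f => [|n IH] f f_inj /=; first exact: resolvable_zero.
pose V i := f [:: i] |: word_vars n (fun w => f (i :: w)).
pose C i U := (f [:: i] \in U) || word_cut n (fun w => f (i :: w)) U.
set P := _ + _ + _.
have branch i : resolvable K (V i) (C i) P.
  apply: resolvable_cone; first last.
  - apply/negP => /mem_word_vars[[//|i' w] /= sw /f_inj].
    by rewrite !inE /= => /(_ sw isT).
  - exact: word_cut0.
  apply: IH => w w' /andP[w0 sw] /andP[w0' sw'] /f_inj.
  by rewrite !inE /= => /(_ sw sw') eqw; case: eqw.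
have memV i x : x \in V i -> exists2 w, (size w <= n)%N & f (i :: w) = x.
  rewrite !inE => /orP[/eqP ->|/mem_word_vars[w /andP[_ sw] <-]]; last by exists w.
  by exists [::].
suff all_branches (s : seq 'I_k) : uniq s ->
    resolvable K (\bigcup_(i <- s) V i) (fun U => all (C^~ U) s) (P ^+ size s).
  have := all_branches _ (enum_uniq 'I_k).
  rewrite size_enum_ord big_enum; apply: resolvable_ext => U.
  by apply/allP/forallP => [h i|h i _]; [apply: h; rewrite mem_enum | apply: h].
elim: s => [_|i s IHs /= /andP[nis us]]; first by rewrite big_nil expr0; apply: resolvable_unit.
rewrite big_cons exprS; apply: resolvable_tensor => //; first exact: IHs.
rewrite disjoints_subset; apply/subsetP => x /memV[w sw fx]; rewrite inE.
apply/negP; rewrite bigcup_seq => /bigcupP[i' i's /memV[w' sw' fx']].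
have [/= e _] : i :: w = i' :: w' by apply: f_inj; rewrite ?inE ?fx.
by rewrite e i's in nis.
Qed.

End WordCuts.

Section VarIdeal.
Variables (K : fieldType) (k n : nat).

(** The ideal of a set of variables is monomial.  For the converse, each monomial
of g is charged to one variable that divides it. *)
Lemma var_idealP (B : {set edge k n}) (g : edge_ring K k n) :
  var_ideal B g <->
  forall u, u \in msupp g -> exists2 e, e \in B & enum_rank e \in mnm_support u.
Proof.
split=> [[c ->] u|hg].
  move=> /msupp_sum_le /flattenP[s /mapP[e]].
  rewrite mem_filter => /andP[eB _] ->; rewrite (perm_mem (msuppMX _ _)) => /mapP[v _ ->].
  by exists e => //; rewrite inE mnmDE mnm1E eqxx.
pose pk u := [pick e in B | enum_rank e \in mnm_support u].
exists (fun e => \sum_(u <- msupp g | pk u == Some e) g@_u *: 'X_[u - U_(enum_rank e)]).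
rewrite {1}[g]mpolyE; under [RHS]eq_bigr do rewrite mulr_suml.
rewrite (exchange_big_dep xpredT) //= big_seq [RHS]big_seq.
apply: eq_bigr => u /hg [e eB eu].
rewrite /pk; case: pickP => [e' /andP[e'B e'u]|/(_ e)]; last by rewrite eB eu.
rewrite (big_pred1 e') => [|e'']; last first.
  rewrite /= andbC eq_sym; case: (e'' =P e') => [->|ne]; rewrite ?eqxx ?e'B //=.
  by case: eqP => // -[].
rewrite -scalerAl -mpolyXD submK //.
apply/mnm_lepP => i; rewrite mnm1E; case: eqP => // <-.
by rewrite lt0n; rewrite inE in e'u.
Qed.

End VarIdeal.

Section TreeWords.
Variables (k n : nat) (e0 : edge k n).
Implicit Types (w : seq 'I_k).

(** The edge that ends at the vertex w; e0 is a default for words that are not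
vertices or are empty. *)
Definition word_edge w : edge k n :=
  insubd e0 (insub_bseq n (take (size w).-1 w), insub_bseq n w).

Lemma insub_bseqE w : (size w <= n)%N -> insub_bseq n w = w :> seq 'I_k.
Proof. by move=> sw; rewrite insubdK. Qed.

Lemma child_step w j : (j < size w)%N -> (size w <= n)%N ->
  @child k n (insub_bseq n (take j w)) (insub_bseq n (take j.+1 w)).
Proof.
case: w => [//|i w]; set s := i :: w => js sn; apply/existsP; exists (nth i s j).
by rewrite !insub_bseqE ?size_take_min ?geq_min ?sn ?orbT // (take_nth i).
Qed.

Lemma val_word_edge w j : (j < size w)%N -> (size w <= n)%N ->
  val (word_edge (take j.+1 w)) = (insub_bseq n (take j w), insub_bseq n (take j.+1 w)).
Proof.
move=> js sn; rewrite /word_edge size_takel // take_takel // insubdK //.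
exact: child_step.
Qed.

Lemma word_edge_inj : {in [pred w | 0 < size w <= n]%N &, injective word_edge}.
Proof.
have snd_val w : (0 < size w <= n)%N -> (val (word_edge w)).2 = w :> seq 'I_k.
  case/andP; case: w => [//|i w] _ sw.
  have := @val_word_edge (i :: w) (size w) (leqnn _) sw.
  by rewrite [take (size w).+1 _]take_oversize // => ->; rewrite insub_bseqE.
by move=> w w' sw sw' eww; rewrite -(snd_val _ sw) -(snd_val _ sw') eww.
Qed.

(** The path through the nonempty prefixes of w, from shortest to longest. *)
Definition word_path w : seq (vertex k n) :=
  [seq insub_bseq n (take j.+1 w) | j <- iota 0 (size w)].

(** Paths from the root are determined by their last vertex. *)
Lemma path_word_path (p : seq (vertex k n)) : path (@child k n) (tree_root k n) p ->
  size (last (tree_root k n) p : seq _) = size p /\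
  p = word_path (last (tree_root k n) p).
Proof.
elim/last_ind: p => [//|p v IH]; rewrite rcons_path last_rcons size_rcons => /andP[].
move=> /IH[sz ep] /existsP[i /eqP ev]; split; first by rewrite ev size_rcons sz.
rewrite /word_path ev size_rcons sz -[(size p).+1]addn1 iotaD map_cat cats1.
congr rcons; last first.
  apply/val_inj; rewrite add0n take_oversize ?size_rcons ?sz //=.
  by rewrite insub_bseqE -ev ?size_bseq.
rewrite {1}ep /word_path sz; apply/eq_in_map => j; rewrite mem_iota add0n => jp.
by rewrite -cats1 takel_cat // sz.
Qed.

Lemma word_path_cons w :
  tree_root k n :: word_path w
  = [seq insub_bseq n (take j w) | j <- iota 0 (size w).+1].
Proof.
rewrite /= take0 (iotaDl 1 0) -map_comp; congr cons.
by apply/val_inj; rewrite /= insub_bseqE.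
Qed.

Lemma zip_word_path w : (size w <= n)%N ->
  zip (tree_root k n :: word_path w) (word_path w)
  = [seq (insub_bseq n (take j w), insub_bseq n (take j.+1 w)) | j <- iota 0 (size w)].
Proof.
move=> sw; rewrite word_path_cons.
rewrite -[(size w).+1]addn1 iotaD map_cat -[word_path w]cats0 zip_cat ?size_map //=.
by rewrite cats0 zip_map.
Qed.

Lemma mem_path_edges_word_path w e : (size w <= n)%N ->
  reflect (exists2 j, (j < size w)%N & e = word_edge (take j.+1 w))
          (e \in path_edges (word_path w)).
Proof.
move=> sw; rewrite inE zip_word_path //.
apply: (iffP mapP) => [[j jw ev]|[j js ->]]; exists j; rewrite ?mem_iota ?val_word_edge //.
  by rewrite mem_iota in jw.
by apply/val_inj; rewrite val_word_edge //; rewrite mem_iota in jw.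
Qed.

(** Without children at all, when k = 0, the root would be a leaf at any
depth. *)
Lemma leafE (v : vertex k n) : (0 < k)%N -> leaf v = (size v == n).
Proof.
move=> k0; apply/forallP/eqP => [lv|sv w].
  apply/eqP; rewrite eqn_leq size_bseq leqNgt; apply/negP => vn.
  have := lv (insub_bseq n (rcons v (Ordinal k0))); apply/negP/negPn.
  by apply/existsP; exists (Ordinal k0); rewrite insub_bseqE // size_rcons.
apply/negP => /existsP[i /eqP ew]; have := size_bseq w.
by rewrite ew size_rcons sv ltnn.
Qed.

Lemma root_leaf_path_word_path w : (0 < k)%N -> size w = n ->
  root_leaf_path (word_path w).
Proof.
move=> k0 sw; have swn : (size w <= n)%N by rewrite sw.
apply/andP; split.
  apply/(pathP (tree_root k n)) => j; rewrite size_map size_iota => js.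
  rewrite word_path_cons.
  rewrite /word_path !(nth_map 0%N) ?size_iota ?(leqW js) // !nth_iota ?(leqW js) // ?add0n.
  exact: child_step.
rewrite leafE // /word_path; case: (posnP n) => [n0|n_gt0].
  by rewrite sw n0.
rewrite -[size w]prednK ?sw // -addn1 iotaD map_cat last_cat /= add0n prednK //.
by rewrite insub_bseqE take_oversize ?sw.
Qed.

End TreeWords.

Lemma cut_ideal_sqf (K : fieldType) k n (e0 : edge k n) (g : edge_ring K k n) :
  (0 < k)%N ->
  cut_ideal g <-> sqf_ideal (word_cut n (fun w => enum_rank (word_edge e0 w))) g.
Proof.
move=> k0; split=> [Jg u ug|Jg p /andP[p_path p_leaf]].
  apply/word_cutP => w sw.
  have swn : (size w <= n)%N by rewrite sw.
  have /var_idealP/(_ u ug)[e] := Jg _ (root_leaf_path_word_path k0 sw).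
  case/(mem_path_edges_word_path e0 e swn) => j jw -> eu; apply/hasP; exists j; last by [].
  by rewrite mem_iota -sw.
apply/var_idealP => u ug; have [sz ->] := path_word_path p_path.
move: p_leaf; rewrite leafE // => /eqP.
set w := last _ p => sw; have /word_cutP/(_ w sw)/hasP[j] := Jg u ug.
rewrite mem_iota add0n => jn eu; exists (word_edge e0 (take j.+1 w)) => //.
have swn : (size w <= n)%N by rewrite sw.
by apply/(mem_path_edges_word_path e0 _ swn); exists j => //; rewrite sw.
Qed.

(** * The generating function of the cut ideal *)

Lemma coef_cells_genfun (K : fieldType) m (L : labelled_complex K m) i j :
  (cells_genfun L)`_i`_j = #|[set b | (hdeg L 0 b == i) && (#|lab L 0 b| == j)]|%:Z.
Proof.
rewrite coef_sum coef_sum -sum1_card -natz natr_sum [RHS]big_mkcond; apply: eq_bigr => b _ /=.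
rewrite inE coefMC coefXn mulr_natl coefMn coefXn [i == _]eq_sym [j == _]eq_sym.
by do 2!case: (_ == _).
Qed.

(** The factor x accounts for the passage from the ideal to its quotient ring.
No cell has an empty label because the ideal is proper, so nothing is lost in
total degree 0. *)
Lemma betti_genfun_resolvable (K : fieldType) m (J : {mpoly K[m]} -> Prop) A
    (Q : {set 'I_m} -> bool) P :
  (forall U V : {set 'I_m}, U \subset V -> Q U -> Q V) -> ~~ Q set0 ->
  (forall f, J f <-> sqf_ideal Q f) -> resolvable K A Q P -> betti_genfun J ('X * P).
Proof.
move=> Qup Q0 JQ [L rL <-] [|i] j; rewrite coefXM /= ?coef0 // coef_cells_genfun.
have hJ := sqf_homogeneous_ideal Qup JQ.
case: j => [|j].
  congr Posz; apply: eq_card0 => b; rewrite inE cards_eq0; apply/negP => /andP[_ /eqP lb0].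
  by move: Q0; rewrite (lab_up rL (b := b)) // lb0.
rewrite (betti_tor_dim hJ (cell_resolution rL Q0 JQ)) tor_dim_cell_resolution; congr Posz.
rewrite -(card_imset _ (@rshift_inj 1 (lsize L))); apply: eq_card => b.
rewrite [RHS]inE /aug_hdeg /aug_lab; case: (split_ordP b) => {}b ->.
  rewrite !row_mxEl [const_mx 0%N _ _]mxE /=; apply/imsetP => -[c _ /eqP].
  by rewrite eq_lrshift.
by rewrite mem_imset ?inE; [rewrite !row_mxEr mxE eqSS | apply: rshift_inj].
Qed.

Lemma word_cutS k m n (f : seq 'I_k -> 'I_m) (U V : {set 'I_m}) :
  U \subset V -> word_cut n f U -> word_cut n f V.
Proof.
move=> /subsetP sUV /word_cutP cut; apply/word_cutP => w /cut.
by apply: sub_has => j /sUV.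
Qed.

Lemma betti_genfun_cut_ideal (K : fieldType) k n : (0 < k)%N -> (0 < n)%N ->
  betti_genfun (@cut_ideal K k n) ('X * cut_cells k n).
Proof.
move=> k0 n0.
have e : @child k n (insub_bseq n [::]) (insub_bseq n [:: Ordinal k0]).
  have := @child_step k n [:: Ordinal k0] 0 isT n0.
  by rewrite take0 take_oversize.
pose e0 : edge k n := Sub (_, _) e.
apply: (betti_genfun_resolvable (Q := word_cut n (fun w => enum_rank (word_edge e0 w)))).
- exact: word_cutS.
- exact: word_cut0.
- by move=> f; apply: cut_ideal_sqf.
apply: resolvable_word_cut => // w w' sw sw' /enum_rank_inj.
exact: word_edge_inj.
Qed.

Lemma cancel_shift (F : fieldType) (a b : F) k : a != 0 ->
  a * b ^+ k.+1 = a ^- k * (a * b) ^+ k.+1.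
Proof.
move=> a0; rewrite exprMn [a ^+ k.+1]exprS -[X in _ = _ * X]mulrA.
by rewrite mulrCA mulKf // expf_neq0.
Qed.

Theorem theorem3p6 (K : fieldType) (k n : nat) (hk : (1 <= k)%N) (hn : (1 < n)%N) :
  exists Gn Gp : {poly {poly int}},
    [/\ betti_genfun (@cut_ideal K k n) Gn,
        betti_genfun (@cut_ideal K k (n - 1)) Gp
      & let x : {poly {poly int}} := 'X in
        let t : {poly {poly int}} := 'X%:P in
        tofrac Gn = (tofrac x) ^- (k - 1)
                    * tofrac (((1 + t * x) * (1 + Gp) - 1) ^+ k)].
Proof.
exists ('X * cut_cells k n), ('X * cut_cells k (n - 1)).
split.
- by apply: betti_genfun_cut_ideal; rewrite // ltnW.
- by apply: betti_genfun_cut_ideal; rewrite // subn_gt0.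
move=> x t; case: n hn => [//|n] _; rewrite subSS subn0 /=.
set P := cut_cells k n.
have -> : (1 + t * x) * (1 + x * P) - 1 = x * (P + t + t * x * P) by ring.
have x0 : tofrac x != 0 by rewrite tofrac_eq0 polyX_eq0.
case: k hk @P => [//|k] _ P; rewrite subSS subn0.
move: (P + t + t * x * P) => Z.
rewrite [LHS]tofracM !tofracXn tofracM.
exact: cancel_shift.
Qed.
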